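(* Let $K$ be a field, let $n\ge d\ge 1$ be integers, and let $R=K[x_1,\dots,x_n]$ be the standard graded polynomial ring in $n$ variables over $K$. Let $I_{n,d}\subseteq R$ be the squarefree Veronese ideal, i.e. the ideal generated by all squarefree monomials of degree $d$ in $R$. Then: (1) The Hilbert series of $I_{n,d}$ is $$H_{I_{n,d}}(T)=\sum_{i=d-1}^{n-1}\binom{i}{d-1}\,T^d\,(1-T)^{-n+i-d+1}.$$ (2) The Hilbert depth of $I_{n,d}$ (in the standard grading) is equal to $$d+\left\lfloor \binom{n}{d+1}\Big/\binom{n}{d}\right\rfloor = d+\left\lfloor \frac{n-d}{d+1}\right\rfloor = d-1+\left\lceil \frac{n-(d-1)}{d+1}\right\rceil.$$
   Context: $R=K[x_1,\dots,x_n]$ carries the standard $\mathbb{Z}$-grading, $\deg x_i=1$. For a finitely generated graded $R$-module $M=\bigoplus_{k\in\mathbb{Z}}M_k$, the Hilbert series of $M$ is the formal Laurent series $H_M(T)=\sum_{k\in\mathbb{Z}}(\dim_K M_k)\,T^k$. Negative powers of $1-T$ are expanded as power series in $T$. A Hilbert decomposition of $M$ is a finite family $\mathscr{H}=(S_i,s_i)$ such that $s_i\in\mathbb{Z}$, each $S_i$ is a graded $K$-algebra retract of $R$, and $M\cong\bigoplus_i S_i(-s_i)$ as graded $K$-vector spaces, where $S_i(-s_i)$ denotes $S_i$ with grading shifted so that its generator $1$ lies in degree $s_i$. (A graded $K$-algebra retract $S$ of $R$ is a graded $K$-algebra with graded $K$-algebra homomorphisms $S\to R\to S$ whose composite is the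 identity of $S$.) The Hilbert depth of $\mathscr{H}$ is $\min_i \operatorname{depth} S_i(-s_i)$, and the Hilbert depth of $M$ is the maximum of the Hilbert depths of all Hilbert decompositions of $M$. *)

(* Defs.v *)
From HB Require Import structures.
From mathcomp Require Import all_boot all_order all_algebra.
From mathcomp Require Import archimedean.
From mathcomp Require Import mpoly.

Set Implicit Arguments.
Unset Strict Implicit.
Unset Printing Implicit Defensive.

Import Order.TTheory GRing.Theory Num.Theory.
Local Open Scope ring_scope.

(* Subspaces, ideals and homogeneous components are Prop-valued predicates on *)
(* an ambient type, since membership in them need not be decidable.           *)

Section LinearAlgebra.
Variables (K : fieldType) (V : lmodType K).

Definition is_subspace (P : V -> Prop) : Prop :=
  P 0 /\ forall (a : K) (u v : V), P u -> P v -> P (a *: u + v).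

Definition has_dim (P : V -> Prop) (m : nat) : Prop :=
  is_subspace P /\
  exists b : 'I_m -> V, (forall i, P (b i)) /\
    forall v, P v -> exists! c : {ffun 'I_m -> K}, v = \sum_i c i *: b i.

(* V is the internal direct sum of the subspaces G k, k in Z. *)
Definition is_grading (G : int -> V -> Prop) : Prop :=
  [/\ forall k, is_subspace (G k),
      forall v, exists (s : seq int) (c : int -> V),
        (forall k, G k (c k)) /\ v = \sum_(k <- s) c k
    & forall (s : seq int) (c : int -> V), uniq s -> (forall k, G k (c k)) ->
        \sum_(k <- s) c k = 0 -> {in s, forall k, c k = 0}].

End LinearAlgebra.

Section Ideals.
Variable A : comNzRingType.

Definition ideal_gen (G : A -> Prop) (f : A) : Prop :=
  exists s : seq (A * A),
    (forall p, p \in s -> G p.2) /\ f = \sum_(p <- s) p.1 * p.2.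

(* Membership in (f_0, ..., f_(i-1)) N, where fs = [:: f_0; f_1; ...]. *)
Definition in_seq_mul (N : lmodType A) (fs : seq A) (i : nat) (x : N) : Prop :=
  exists c : nat -> N, x = \sum_(j < i) fs`_j *: c j.

Definition regular_seq (N : lmodType A) (fs : seq A) : Prop :=
  (forall i, (i < size fs)%N -> forall x : N,
      in_seq_mul fs i (fs`_i *: x) -> in_seq_mul fs i x) /\
  (exists x : N, ~ in_seq_mul fs (size fs) x).

(* The maximal length of an N-regular sequence of elements of J is r. *)
Definition is_grade (J : A -> Prop) (N : lmodType A) (r : nat) : Prop :=
  (exists fs : seq A,
      [/\ {in fs, forall f, J f}, regular_seq N fs & size fs = r]) /\
  (forall fs : seq A,
      {in fs, forall f, J f} -> regular_seq N fs -> (size fs <= r)%N).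

End Ideals.

(* B as an A-module by restriction of scalars along f. *)
Definition restrict_scalars (A B : nzRingType) (f : {rmorphism A -> B}) : Type
  := B.

Section RestrictScalars.
Variables (A B : nzRingType) (f : {rmorphism A -> B}).

HB.instance Definition _ := GRing.Zmodule.copy (restrict_scalars f) B.

Definition restrict_scale (a : A) (x : restrict_scalars f)
  : restrict_scalars f := (f a * (x : B) : B).

Lemma restrict_scaleA (a b : A) (x : restrict_scalars f) :
  restrict_scale a (restrict_scale b x) = restrict_scale (a * b) x.
Proof. by rewrite /restrict_scale rmorphM mulrA. Qed.

Lemma restrict_scale1 : left_id 1 restrict_scale.
Proof. by move=> x; rewrite /restrict_scale rmorph1 mul1r. Qed.

Lemma restrict_scaleDr : right_distributive restrict_scale +%R.
Proof. by move=> a x y; exact: (@mulrDr B). Qed.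

Lemma restrict_scaleDl (x : restrict_scalars f) :
  {morph restrict_scale^~ x : a b / a + b}.
Proof. by move=> a b; rewrite /restrict_scale rmorphD; exact: (@mulrDl B). Qed.

HB.instance Definition _ := GRing.Zmodule_isLmodule.Build A (restrict_scalars f)
  restrict_scaleA restrict_scale1 restrict_scaleDr restrict_scaleDl.

End RestrictScalars.

Section PolynomialRing.
Variables (K : fieldType) (n : nat).

Local Notation R := {mpoly K[n]}.

Definition mpoly_comp (k : int) (f : R) : Prop :=
  match k with
  | Posz j => f \is j.-homog
  | Negz _ => f = 0
  end.

Definition irrelevant_ideal : R -> Prop :=
  ideal_gen (fun g : R => exists i : 'I_n, g = 'X_i).

Definition is_depth (N : lmodType R) (r : nat) : Prop :=
  is_grade irrelevant_ideal N r.

Record graded_retract := GradedRetract {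
  retr_alg :> comAlgType K;
  retr_comp : int -> retr_alg -> Prop;
  retr_incl : {lrmorphism retr_alg -> R};
  retr_proj : {lrmorphism R -> retr_alg};
  retr_grading : is_grading retr_comp;
  retr_comp1 : retr_comp 0 1;
  retr_compM : forall (j k : int) (x y : retr_alg),
    retr_comp j x -> retr_comp k y -> retr_comp (j + k) (x * y);
  retr_incl_comp : forall k x, retr_comp k x -> mpoly_comp k (retr_incl x);
  retr_proj_comp : forall k f, mpoly_comp k f -> retr_comp k (retr_proj f);
  retr_inclK : cancel retr_incl retr_proj
}.

(* A retract S is regarded as an R-module through the retraction R -> S.      *)
(* A degree shift S(-s) does not change the module, nor hence its depth.      *)
Definition retr_module (S : graded_retract) : lmodType R :=
  restrict_scalars (retr_proj S).

(* From here on, M is a homogeneous subspace of a K-vector space V graded by  *)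
(* the subspaces G k: its component of degree k is the intersection of M with *)
(* G k.                                                                       *)
Section HilbertDepth.
Variables (V : lmodType K) (G : int -> V -> Prop) (M : V -> Prop).

Definition is_hilbert_series (H : int -> int) : Prop :=
  forall k : int, exists m : nat,
    has_dim (fun v => M v /\ G k v) m /\ H k = m%:Z.

(* A K-linear map from the direct sum of the S i to V amounts to a family of  *)
(* linear maps phi i.  The last three clauses say that it has degree 0 for    *)
(* the gradings shifted by the s i, that its image is M, and that it is       *)
(* injective.                                                                 *)
Definition is_hilbert_decomposition (m : nat) (S : 'I_m -> graded_retract)
    (s : 'I_m -> int) : Prop :=
  exists phi : forall i, {linear S i -> V},
    [/\ forall i k (x : S i), retr_comp k x -> G (k + s i) (phi i x),
        forall v, M v <-> exists x : forall i, S i, v = \sum_i phi i (x i)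
      & forall x : forall i, S i,
          \sum_i phi i (x i) = 0 -> forall i, x i = 0].

Definition has_decomposition_of_depth (r : nat) : Prop :=
  exists (m : nat) (S : 'I_m -> graded_retract) (s : 'I_m -> int),
    [/\ is_hilbert_decomposition S s,
        exists i, is_depth (retr_module (S i)) r
      & forall i r', is_depth (retr_module (S i)) r' -> (r <= r')%N].

Definition is_hilbert_depth (r : nat) : Prop :=
  has_decomposition_of_depth r /\
  forall r', has_decomposition_of_depth r' -> (r' <= r)%N.

End HilbertDepth.

Definition squarefree_veronese (d : nat) : R -> Prop :=
  ideal_gen (fun g : R => exists m : 'X_{1..n},
    [/\ forall i, (m i <= 1)%N, mdeg m = d & g = 'X_[m]]).

End PolynomialRing.

(* Power series over int as coefficient functions nat -> int, and formal      *)
(* Laurent series as coefficient functions int -> int.                        *)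

Definition fps_one : nat -> int := fun k => (k == 0%N)%:R.

Definition fps_mul (f g : nat -> int) : nat -> int :=
  fun k => \sum_(i < k.+1) f i * g (k - i)%N.

Definition fps_exp (f : nat -> int) (m : nat) : nat -> int :=
  iter m (fps_mul f) fps_one.

Definition fps_1subT : nat -> int := fun k => (k == 0%N)%:R - (k == 1%N)%:R.

Definition fps_geom : nat -> int := fun=> 1.

Lemma fps_1subT_geom : fps_mul fps_1subT fps_geom =1 fps_one.
Proof.
move=> k; rewrite /fps_mul /fps_1subT /fps_geom /fps_one.
rewrite big_ord_recl /= mulr1 subr0.
case: k => [|k]; first by rewrite big_ord0 addr0.
rewrite big_ord_recl big1 /= => [|i _]; first by rewrite mulr1 addr0 sub0r subrr.
by rewrite subrr mul0r.
Qed.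

(* (1 - T) ^ e *)
Definition fps_1subT_pow (e : int) : nat -> int :=
  match e with
  | Posz m => fps_exp fps_1subT m
  | Negz m => fps_exp fps_geom m.+1
  end.

(* T ^ d * f *)
Definition laurent_shift (d : nat) (f : nat -> int) : int -> int :=
  fun k => if k - d%:Z is Posz j then f j else 0.

(* Main.v *)
Require Import Defs.
From HB Require Import structures.
From mathcomp Require Import all_boot all_order all_algebra.
From mathcomp Require Import archimedean zify ring.
From mathcomp Require Import ssrcomplements mpoly.

Set Implicit Arguments.
Unset Strict Implicit.
Unset Printing Implicit Defensive.

Import Order.TTheory GRing.Theory Num.Theory.
Local Open Scope ring_scope.

(* The ideal I is spanned by the monomials whose support has at least d        *)
(* elements, so dim I_k = sum_(s >= d) C(n, s) C(k - 1, s - 1); telescoping in *)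
(* d turns this into the stated Hilbert series.                                *)
(*                                                                            *)
(* Upper bound: a retract S of R is generated by a basis of S_1, whose         *)
(* dimension r bounds the depth of S, because the monomials in a regular       *)
(* sequence are linearly independent over K.  In a Hilbert decomposition of I  *)
(* of depth h all shifts are >= d, at least dim I_d = C(n, d) of them are      *)
(* equal to d, and each of the latter contributes r >= h to the dimension      *)
(* d C(n, d) + C(n, d + 1) of I_(d + 1).                                       *)
(*                                                                            *)
(* Lower bound: put q = floor((n - d) / (d + 1)) and h = d + q.  Grouped by    *)
(* support, H_I = sum_(s >= d) C(n, s) T^s / (1 - T)^s.  The summands with     *)
(* s > h are kept; those with s <= h add up to T^d B(T) / (1 - T)^h, where     *)
(* B = sum_(t <= q) C(n, d + t) T^t (1 - T)^(q - t).  A first-order            *)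
(* differential equation for B gives a recurrence for its coefficients that    *)
(* shows them to be nonnegative, so B(T) / (1 - T)^h is the Hilbert series of  *)
(* a sum of shifted polynomial rings in h variables.                           *)

(** * Counting monomials and the Hilbert function *)

(** A Hilbert decomposition sees only dimensions: by [numerical_decomposition], every finite family
    of shifted polynomial rings, each in between 1 and n variables, with the right Hilbert function
    is realised by a decomposition. The lower bound thus becomes a question about nonnegative
    integers, settled by [bernstein_coef_ge0]. The upper bound compares only the degrees d and d + 1
    of the ideal ([card_shift_d], [card_shift_d_mul]), after [regular_seq_size_leq] has bounded
    depth by a number of linear forms. The two bounds meet because C(n, d + 1) / C(n, d) = (n - d) /
    (d + 1). For the Hilbert series, [sum_support_eq] is the combinatorial core of
    [veronese_hilbert_seriesE]. *)

Section Compositions.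
Local Open Scope nat_scope.

(** Exponent vectors of the monomials of degree [k] in [n] variables, as an explicit list so that
    counting goes by recursion on the first entry. *)
Fixpoint compositions (n k : nat) : seq (seq nat) :=
  if n is n'.+1 then
    [seq e :: c | e <- iota 0 k.+1, c <- compositions n' (k - e)]
  else if k is 0 then [:: [::]] else [::].

Lemma compositionsS n k : compositions n.+1 k =
  [seq e :: c | e <- iota 0 k.+1, c <- compositions n (k - e)].
Proof. by []. Qed.

Lemma mem_compositions n k c :
  (c \in compositions n k) = (size c == n) && (sumn c == k).
Proof.
elim: n k c => [|n IHn] k c.
  by case: k => [|k]; case: c => [|e c] //=; rewrite inE.
rewrite compositionsS; apply/allpairsPdep/idP => [[e [c' [eI c'I ->]]]|].
  move: eI c'I; rewrite mem_iota IHn /= => ek /andP[/eqP-> /eqP->].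
  by rewrite eqxx; lia.
case: c => [|e c] //=; rewrite eqSS => /andP[sc /eqP ck].
exists e, c; split=> //; first by rewrite -[0 :: _]/(iota 0 k.+1) mem_iota; lia.
by rewrite IHn sc -ck addKn /=.
Qed.

Lemma compositions_uniq n k : uniq (compositions n k).
Proof.
elim: n k => [|n IHn] k; first by case: k.
rewrite compositionsS.
apply: allpairs_uniq_dep => [|e _|]; rewrite ?iota_uniq //.
by move=> [e c] [e' c'] _ _ /= [-> ->].
Qed.

Lemma size_compositions n k : size (compositions n.+1 k) = 'C(k + n, n).
Proof.
elim: n k => [|n IHn] k.
  rewrite bin0 compositionsS size_allpairs_dep.
  rewrite sumnE big_map -[iota _ _]/(index_iota 0 k.+1).
  rewrite big_nat_recr //= subnn /=.
  by rewrite big_nat big1 // => i /andP[_ ik]; rewrite -(subnSK ik).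
rewrite compositionsS size_allpairs_dep sumnE big_map.
under eq_bigr do rewrite IHn.
rewrite -[iota _ _]/(index_iota 0 k.+1).
elim: k => [|k IHk]; first by rewrite big_nat1 !binn.
rewrite big_nat_recl //= subn0 (eq_bigr (fun i => 'C(k - i + n, n))) => [|//].
by rewrite IHk !addSn !addnS binS addnC.
Qed.

Definition nnz (c : seq nat) := count (predC1 0) c.

(* The number of compositions of k into s positive parts. *)
Definition pos_compositions_card s k :=
  if s is s'.+1 then if k is k'.+1 then 'C(k', s') else 0 else (k == 0 : nat).

Lemma sum_pos_compositions_card s k :
  \sum_(0 <= j < k) pos_compositions_card s j = pos_compositions_card s.+1 k.
Proof.
elim: k => [|k IHk]; first by rewrite big_geq.
rewrite big_nat_recr //= IHk; case: k {IHk} => [|k].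
  by case: s => [|s] //=; rewrite bin0n.
by case: s => [|s] /=; rewrite ?addn0 ?bin0 // binS addnC.
Qed.

(** Choose the support, then a positive composition on it. The induction separates a zero first
    entry from a positive one, which is Pascal's rule for ['C(n, s)]. *)
Lemma count_compositions n s k :
  count (fun c => nnz c == s) (compositions n k) =
  'C(n, s) * pos_compositions_card s k.
Proof.
elim: n s k => [|n IHn] s k.
  by case: k s => [|k] [|s] //=; rewrite bin0n /= ?muln0.
rewrite compositionsS count_flatten sumnE !big_map.
rewrite -[iota _ _]/(index_iota 0 k.+1) big_nat_recl //= subn0 count_map.
rewrite (eq_count (a2 := fun c => nnz c == s)) => [|c //].
rewrite IHn (eq_bigr (fun i => if s is s'.+1 then
    'C(n, s') * pos_compositions_card s' (k - i.+1) else 0)); last first.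
  move=> i _; rewrite count_map; case: s => [|s].
    by rewrite -[RHS](count_pred0 (compositions n (k - i.+1))); apply: eq_count.
  by rewrite -IHn; apply: eq_count.
case: s => [|s]; first by rewrite big1 // addn0 !bin0.
rewrite -big_distrr /= binS mulnDl; congr (_ + _ * _).
rewrite -/(pos_compositions_card s.+1 k) -sum_pos_compositions_card.
rewrite [RHS]big_nat_rev /=; apply: eq_big_nat => i _.
by rewrite add0n.
Qed.

End Compositions.

Section Telescope.
Local Open Scope nat_scope.

(** Pascal's rule for ['C(n - j, d.+1)] and ['C(k + j.+1, j.+1 + d)]; it moves a boundary term from
    [j] to [j.+1]. *)
Lemma telescope_term n d k j : j < n ->
  'C(n - j, d.+1) * 'C(k + j, j + d)
    + 'C(n - j.+1, d.+1) * 'C(k + j, j + d.+1) =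
  'C(n - j.+1, d.+1) * 'C(k + j.+1, j.+1 + d)
    + 'C(n - j.+1, d) * 'C(k + j, j + d).
Proof.
move=> jn; rewrite -(subnSK jn) binS !addnS addSn binS; nia.
Qed.

(** Descending induction on [d]: lowering [d] by one adds a single term on the left, which
    [telescope_term] carries along the sum until it vanishes at the end. For the ideal generated in
    degree [d.+1], the left side is its dimension in degree [k.+1], and the right side is the
    coefficient of the stated series with reversed summation index. *)
Lemma sum_support_eq n d k : 0 < n ->
  \sum_(d.+1 <= s < n.+1) 'C(n, s) * 'C(k, s.-1) =
  \sum_(0 <= j < n) 'C(n - j.+1, d) * 'C(k + j, j + d).
Proof.
move=> n0; have [e] := ubnP (n.+1 - d); elim: e d => // e IHe d.
have [nd _|dn] := leqP n d.
  rewrite big_geq // big_nat big1 // => j /andP[_ jn].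
  by rewrite bin_small //; lia.
move=> nde; rewrite big_ltn // IHe; last by lia.
suff tel m : m <= n ->
  'C(n, d.+1) * 'C(k, d) +
  \sum_(0 <= j < m) 'C(n - j.+1, d.+1) * 'C(k + j, j + d.+1) =
  'C(n - m, d.+1) * 'C(k + m, m + d) +
  \sum_(0 <= j < m) 'C(n - j.+1, d) * 'C(k + j, j + d).
  by rewrite /= tel // subnn bin0n add0n.
elim: m => [|m IHm] mn; first by rewrite !big_geq // subn0 !addn0.
rewrite !big_nat_recr //= addnA IHm ?(ltnW mn) //.
by have := telescope_term d k mn; lia.
Qed.

End Telescope.

(** Multiplying by the geometric series takes partial sums, so the induction is the hockey-stick
    identity. *)
Lemma fps_exp_geom m k : fps_exp fps_geom m.+1 k = 'C(k + m, m)%:Z.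
Proof.
have step g j : fps_mul fps_geom g j = \sum_(0 <= i < j.+1) g i.
  rewrite /fps_mul [RHS]big_nat_rev big_mkord; apply: eq_bigr => i _.
  by rewrite mul1r.
elim: m k => [|m IHm] k.
  rewrite bin0 /fps_exp /= step /fps_one big_ltn //=.
  by rewrite big_nat big1 ?addr0 // => i; case: i.
have -> : fps_exp fps_geom m.+2 k = fps_mul fps_geom (fps_exp fps_geom m.+1) k.
  by [].
rewrite step; under eq_bigr do rewrite IHm.
elim: k => [|k IHk]; first by rewrite big_nat1 !binn.
by rewrite big_nat_recr //= IHk !addSn !addnS binS PoszD.
Qed.

Section HilbertFunction.
Local Open Scope nat_scope.

(* The number of monomials of degree k - s in p variables, for p > 0. *)
Definition shifted_hf p s k := if s <= k then 'C(k - s + p.-1, p.-1) else 0.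

(** Coefficient form of 1 / (1 - T)^(p + 1) = T / (1 - T)^(p + 1) + 1 / (1 - T)^p, multiplied by
    T^s. *)
Lemma shifted_hfS p s k : 0 < p ->
  shifted_hf p.+1 s k = shifted_hf p.+1 s.+1 k + shifted_hf p s k.
Proof.
case: p => // p _; rewrite /shifted_hf /=.
have [ks|sk|->] := ltngtP k s; last 2 first.
- by rewrite -(subnSK sk) !addSn !addnS binS.
- by rewrite subnn !binn.
by rewrite addn0.
Qed.

(** Subtracting one from each of the [s] parts leaves the exponents of an arbitrary monomial of
    degree [k - s]. *)
Lemma pos_compositions_cardE s k : 0 < s ->
  pos_compositions_card s k = shifted_hf s s k.
Proof.
case: s => // s _; rewrite /shifted_hf; case: k => [|k] //=.
rewrite ltnS subSS; case: leqP => sk; first by rewrite subnK.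
by rewrite bin_small.
Qed.

End HilbertFunction.

(** * Nonnegativity of the numerator B *)

Section Bernstein.
Variables (n d q : nat).
Hypotheses (d_gt0 : (0 < d)%N) (qn : (q * d.+1 <= n - d)%N) (dn : (d <= n)%N).

Let c t : int := 'C(n, d + t)%:Z.
Let e t : {poly int} := 'X^t * (1 - 'X) ^+ (q - t).
(** Numerator of sum_(t <= q) C(n, d + t) T^t / (1 - T)^(d + t) over the denominator (1 - T)^(d +
    q). The [e t] are Bernstein polynomials of degree [q] without their binomial factors. *)
Let B : {poly int} := \sum_(0 <= t < q.+1) c t *: e t.

(* Coefficientwise form of                                                     *)
(* T^t (1 - T)^r / (1 - T)^(d + t + r) = T^t / (1 - T)^(d + t), shifted by d.  *)
Lemma shifted_hf_bernstein r t m k : (t + r < m)%N ->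
  \sum_(0 <= j < m) ('X^t * (1 - 'X) ^+ r : {poly int})`_j *
     (shifted_hf (d + t + r) (d + j) k)%:Z =
  (shifted_hf (d + t) (d + t) k)%:Z.
Proof.
elim: r m => [|r IHr] [//|m] trm.
  rewrite expr0 mulr1 !addn0 (bigD1_seq t) ?iota_uniq ?mem_index_iota //=.
    rewrite coefXn eqxx mul1r big1 ?addr0 // => j /negPf jt.
    by rewrite coefXn jt mul0r.
  by rewrite addn0 in trm; lia.
have -> : 'X^t * (1 - 'X) ^+ r.+1 =
   'X^t * (1 - 'X) ^+ r - 'X * ('X^t * (1 - 'X) ^+ r) :> {poly int}.
  by rewrite exprS; ring.
set P := 'X^t * _.
(* [P] has degree at most [t + r], which is below [m], so shifting its coefficients by one loses
   nothing at the top of the range. *)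
have P0 : P`_m = 0.
  apply/leq_sizeP: (leqnn m); apply: leq_trans (size_polyMleq _ _) _.
  have s2 : size (1 - 'X : {poly int}) = 2.
    by rewrite -[1 - 'X]opprB size_polyN size_XsubC.
  have := size_poly_exp_leq (1 - 'X : {poly int}) r.
  rewrite s2 mul1n size_polyXn /= => sr.
  by apply: leq_trans (leq_add (leqnn t) sr) _; lia.
rewrite -(IHr m); last by lia.
under eq_bigr do rewrite coefB coefXM mulrBl.
rewrite sumrB big_nat_recl // big_nat_recl //= -/P.
rewrite mul0r add0r.
have shift (u : nat -> int) :
    P`_0 * u 0%N + \sum_(0 <= i < m) P`_i.+1 * u i.+1 =
    \sum_(0 <= i < m) P`_i * u i.
  rewrite -(big_nat_recl m 0 (fun i => P`_i * u i)) // big_nat_recr //=.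
  by rewrite P0 mul0r addr0.
rewrite (shift (fun j => (shifted_hf (d + t + r.+1) (d + j) k)%:Z)).
rewrite -sumrB.
apply: eq_bigr => j _; rewrite -mulrBr; congr (_ * _).
by rewrite addnS shifted_hfS ?PoszD ?addrK ?addnS 1?addrC ?addKr //; lia.
Qed.

(** Since X (1 - X) e_t' = (t - q X) e_t, the operator on the left sends c_t e_t to c_t ((d + t) (1
    - X) - (n - d - t) X) e_t. As (d + t + 1) c_(t+1) = (n - d - t) c_t, this is a difference
    [g t - g t.+1], and only the two ends survive. *)
Lemma bernstein_ode :
  'X * B^`() - 'X * ('X * B^`()) + d%:Z *: B - (n - q)%N%:Z *: ('X * B) =
  (d%:Z * c 0) *: (1 - 'X) ^+ q.+1 - ((d + q.+1)%N%:Z * c q.+1) *: 'X^(q.+1).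
Proof.
pose g t : {poly int} :=
  ((d + t)%N%:Z * c t) *: ('X^t * (1 - 'X) ^+ (q.+1 - t)).
have -> : (d%:Z * c 0) *: (1 - 'X) ^+ q.+1 = g 0%N.
  by rewrite /g expr0 mul1r subn0 addn0.
have -> : ((d + q.+1)%N%:Z * c q.+1) *: 'X^(q.+1) = g q.+1.
  by rewrite /g subnn expr0 mulr1.
have -> : g 0%N - g q.+1 = \sum_(0 <= t < q.+1) (g t - g t.+1).
  by rewrite -[RHS]opprK -sumrN; under eq_bigr do rewrite opprB;
     rewrite telescope_sumr // opprB.
have -> : 'X * B^`() - 'X * ('X * B^`()) + d%:Z *: B - (n - q)%N%:Z *: ('X * B)
    = 'X * (1 - 'X) * B^`() + (d%:Z%:P - (n - q)%N%:Z%:P * 'X) * B.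
  by rewrite -!mul_polyC; ring.
rewrite /B raddf_sum /= !mulr_sumr -big_split /=.
apply: eq_big_nat => t /andP[_]; rewrite ltnS => tq.
rewrite /g derivZ.
have cE : (d + t.+1)%N%:Z * c t.+1 = (n%:Z - (d + t)%N%:Z) * c t.
  have [ndt|ndt] := ltnP n (d + t).
    by rewrite /c !bin_small ?mulr0 //; lia.
  by rewrite subzn // /c -!PoszM addnS mul_bin_left.
rewrite cE subSS (subSn tq) exprS.
have eE : 'X * (1 - 'X) * (e t)^`() = (t%:R - q%:R * 'X) * e t.
  rewrite /e; have [r ->] : {r | q = (t + r)%N} by exists (q - t)%N; lia.
  rewrite addKn derivM derivXn deriv_exp derivB derivC derivX.
  have X1 : 'X * ('X^(t.-1) *+ t) = t%:R * 'X^t :> {poly int}.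
    case: t {tq cE} => [|t]; rewrite ?mul0r ?mulr0n ?mulr0 //=.
    by rewrite -mulr_natl exprS; ring.
  have X2 : (1 - 'X) * ((1 - 'X) ^+ r.-1 *+ r) =
    r%:R * (1 - 'X)^+r :> {poly int}.
    case: r => [|r]; rewrite ?mul0r ?mulr0n ?mulr0 //=.
    by rewrite -mulr_natl exprS; ring.
  transitivity ('X * ('X^(t.-1) *+ t) * (1 - 'X) * (1 - 'X) ^+ r - (1 - 'X) *
     ((1 - 'X) ^+ r.-1 *+ r) * 'X * 'X^t : {poly int}).
    by rewrite -mulr_natl -(mulr_natl (_ * _)); ring.
  by rewrite X1 X2 natrD; ring.
rewrite -scalerAr eE -!scalerAr -scalerDr -!mul_polyC !polyCM polyCB.
have qn' : (q <= n)%N by nia.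
rewrite -subzn // PoszD polyCB polyCD -!natz !polyC_natr /e !exprS; ring.
Qed.

Let D : int := d%:Z * 'C(n, d)%:Z.

Lemma coef_1subX_exp m k :
  ((1 - 'X) ^+ m : {poly int})`_k = (-1) ^+ k * 'C(m, k)%:Z.
Proof.
elim: m k => [|m IHm] k.
  by rewrite expr0 coef1 bin0n; case: k => [|k] /=; rewrite ?mulr0.
rewrite exprS mulrBl mul1r coefB coefXM IHm; case: k => [|k] /=.
  by rewrite !bin0 subr0.
by rewrite IHm binS PoszD exprS; ring.
Qed.

Lemma bernstein_coef0 : B`_0 = 'C(n, d)%:Z.
Proof.
have /(congr1 (fun p : {poly int} => p`_0)) := bernstein_ode.
rewrite !(coefB, coefD) !coefZ !coefXM coef_1subX_exp coefXn /=.
rewrite /c bin0 addn0 !mulr0 !subr0 add0r expr0 !mulr1.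
by apply: mulfI; rewrite -lt0n.
Qed.

(** Coefficient of X^(k + 1) in the differential equation; as [k < q], the end term in X^(q + 1)
    does not contribute. *)
Lemma bernstein_coef_rec k : (k < q)%N ->
  (k.+1 + d)%N%:Z * B`_k.+1 =
  (n - q + k)%N%:Z * B`_k + (-1) ^+ k.+1 * (D * 'C(q.+1, k.+1)%:Z).
Proof.
move=> kq; have /(congr1 (fun p : {poly int} => p`_k.+1)) := bernstein_ode.
rewrite !(coefB, coefD) !coefZ !coefXM coef_1subX_exp coefXn /=.
rewrite eqSS (ltn_eqF kq) mulr0 subr0 coef_deriv /= /c addn0 -/D.
have -> : (if k == 0%N then 0 else B^`()`_k.-1) = k%:Z * B`_k.
  by case: (k) => [|j]; rewrite ?mul0r //= coef_deriv -mulr_natl natz.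
rewrite -mulr_natl natz !PoszD => E.
by rewrite -[RHS]addr0 mulrCA -E; ring.
Qed.

(* The forcing term of the recurrence is negative only at odd indices, and is  *)
(* then compensated by its positive value one step earlier.                    *)
Lemma bernstein_coef_ge0 k : (k <= q)%N -> 0 <= B`_k.
Proof.
have D_ge0 : 0 <= D by rewrite /D -PoszM.
have qn' : (d + q * d.+1 <= n)%N by lia.
have step k' : (k' < q)%N -> ~~ odd k' ->
    D * 'C(q.+1, k')%:Z <= (k' + d)%N%:Z * B`_k' -> 0 <= B`_k'.+1.
  move=> kq' ek IH; have := bernstein_coef_rec kq'.
  rewrite -signr_odd /= ek expr1 mulN1r => E.
  have F : (k'.+1)%:Z * 'C(q.+1, k'.+1)%:Z = (q.+1 - k')%N%:Z * 'C(q.+1, k')%:Z.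
    by rewrite -!PoszM mul_bin_left.
  (* The hypothesis q (d + 1) <= n - d enters here; if it is an equality, so is this bound at
     [k' = 0]. *)
  have G : ((k' + d) * (q.+1 - k') <= (n - q + k') * k'.+1)%N.
    have -> : (q.+1 - k' = (q - k').+1)%N by lia.
    have : (d + q * d + k' <= n - q + k')%N by nia.
    have : ((k' + d) * (q - k').+1 <= (d + q * d + k') * k'.+1)%N by nia.
    by nia.
  (* Scaled by (k' + d) and k' + 1, the right side of the recurrence is a sum of two terms, one
     nonnegative by [IH] and the other by [G]. *)
  have : 0 <= ((k' + d) * k'.+1)%N%:Z * ((k'.+1 + d)%N%:Z * B`_k'.+1).
    rewrite E.
    have -> : ((k' + d) * k'.+1)%N%:Z *
      ((n - q + k')%N%:Z * B`_k' - D * 'C(q.+1, k'.+1)%:Z) =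
      ((n - q + k') * k'.+1)%N%:Z *
        ((k' + d)%N%:Z * B`_k' - D * 'C(q.+1, k')%:Z) +
      (((n - q + k') * k'.+1)%N%:Z - ((k' + d) * (q.+1 - k'))%N%:Z) *
        (D * 'C(q.+1, k')%:Z).
      rewrite !PoszM; transitivity ((k' + d)%N%:Z * (k'.+1%:Z *
        ((n - q + k')%N%:Z * B`_k') - D * (k'.+1%:Z * 'C(q.+1, k'.+1)%:Z))).
        by ring.
      by rewrite F; ring.
    by rewrite addr_ge0 // mulr_ge0 ?subr_ge0 // mulr_ge0.
  by rewrite pmulr_rge0 ?pmulr_rge0 // -?[0]/(0%:Z) ?ltz_nat //; lia.
(* At even indices more than nonnegativity is needed: the bound has to pay for the negative forcing
   term of the next step. *)
have even j : (j.*2 <= q)%N ->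
    D * 'C(q.+1, j.*2)%:Z <= (j.*2 + d)%N%:Z * B`_(j.*2).
  elim: j => [|j IHj] jq; first by rewrite bin0 mulr1 bernstein_coef0.
  have j1q : (j.*2.+1 < q)%N by rewrite doubleS in jq.
  have B1 := step _ (ltnW j1q) (negbT (odd_double j)) (IHj (ltnW (ltnW j1q))).
  rewrite doubleS bernstein_coef_rec // -signr_odd /= odd_double expr0 mul1r.
  by rewrite lerDr mulr_ge0.
move=> kq; have [ok|ek] := boolP (odd k).
  have kE : k = (k./2).*2.+1 by rewrite -[LHS]odd_double_half ok.
  rewrite kE in kq *.
  by apply: step; rewrite ?odd_double ?even // ltnW.
have kE : k = (k./2).*2 by rewrite -[LHS]odd_double_half (negPf ek).
rewrite kE in kq *.
have : 0 <= (k./2.*2 + d)%N%:Z * B`_(k./2.*2).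
  by apply: le_trans (even _ kq); rewrite mulr_ge0.
by rewrite pmulr_rge0 // ltz_nat; lia.
Qed.

(** The coefficients of B become multiplicities of rings in [d + q] variables. The value of [a 0] is
    recorded so that such a ring is known to occur. *)
Lemma bernstein_decomposition : exists a : nat -> nat,
  a 0%N = 'C(n, d) /\ forall k,
  (\sum_(0 <= t < q.+1) 'C(n, d + t) * shifted_hf (d + t) (d + t) k =
   \sum_(0 <= j < q.+1) a j * shifted_hf (d + q) (d + j) k)%N.
Proof.
exists (fun j => absz B`_j); split=> [|k]; first by rewrite bernstein_coef0.
apply/eqP; rewrite -eqz_nat !(big_morph Posz PoszD (erefl _)); apply/eqP.
transitivity (\sum_(0 <= j < q.+1) B`_j * (shifted_hf (d + q) (d + j) k)%:Z).
  under [RHS]eq_bigr do rewrite coef_sum mulr_suml.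
  rewrite exchange_big_nat; apply: eq_big_nat => t /andP[_ tq].
  under eq_bigr do rewrite coefZ -mulrA.
  rewrite -mulr_sumr PoszM; congr (_ * _).
  rewrite -(@shifted_hf_bernstein (q - t) t q.+1); last by lia.
  by apply: eq_bigr => j _; rewrite -addnA subnKC.
apply: eq_big_nat => j /andP[_ jq].
by rewrite PoszM gez0_abs // bernstein_coef_ge0.
Qed.

End Bernstein.

(** * Regular sequences and linear independence *)

Section LinearIndependence.

Lemma lin_indep_leq (K : fieldType) (V : lmodType K) (I J : finType)
    (u : I -> V) (w : J -> V) (M : I -> J -> K) :
  (forall i, u i = \sum_j M i j *: w j) ->
  (forall c : I -> K, \sum_i c i *: u i = 0 -> forall i, c i = 0) ->
  (#|I| <= #|J|)%N.
Proof.
move=> uE indep.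
pose A := \matrix_(i < #|I|, j < #|J|) M (enum_val i) (enum_val j).
suff /eqP <- : row_free A by apply: rank_leq_col.
apply: inj_row_free => v vA; apply/rowP => i0; rewrite mxE.
have vE i : v 0 i = v 0 (enum_rank (enum_val i)) by rewrite enum_valK.
rewrite vE; apply: (indep (fun i => v 0 (enum_rank i))).
under eq_bigr do rewrite uE scaler_sumr.
rewrite exchange_big big1 //= => j _.
under eq_bigr do rewrite scalerA.
rewrite -scaler_suml (reindex (@enum_val _ I)) /=; last first.
  by apply: onW_bij; apply: enum_val_bij.
have /rowP/(_ (enum_rank j)) := vA; rewrite !mxE => vAj.
rewrite -[X in X *: _](_ : 0 = _) ?scale0r // -[LHS]vAj.
by apply: eq_bigr => i _; rewrite !mxE enum_valK enum_rankK.
Qed.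

Lemma lin_indep_leq_in (K : fieldType) (V : lmodType K) (I J : finType)
    (A : {pred I}) (B : {pred J}) (u : I -> V) (w : J -> V) (M : I -> J -> K) :
  {in A, forall i, u i = \sum_(j in B) M i j *: w j} ->
  (forall c : I -> K, \sum_(i in A) c i *: u i = 0 ->
    {in A, forall i, c i = 0}) ->
  (#|A| <= #|B|)%N.
Proof.
move=> uE indep; rewrite -(card_ord #|A|) -(card_ord #|B|).
apply: (@lin_indep_leq K V _ _ (fun i : 'I_#|A| => u (enum_val i))
  (fun j : 'I_#|B| => w (enum_val j)) (fun i j => M (enum_val i) (enum_val j))).
  by move=> i; rewrite uE ?enum_valP // big_enum_val.
move=> c c0 i; have iA := enum_valP i.
rewrite -(enum_valK_in iA i); apply: (indep
  (fun x => c (enum_rank_in iA x))) => //.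
by rewrite big_enum_val -[RHS]c0; apply: eq_bigr => j _; rewrite enum_valK_in.
Qed.

Lemma big_tuple_cons (R : nmodType) (T : finType) t (F : t.+1.-tuple T -> R) :
  \sum_a F a = \sum_(x : T) \sum_(a : t.-tuple T) F [tuple of x :: a].
Proof.
rewrite pair_big /=
  (reindex (fun p : T * t.-tuple T => [tuple of p.1 :: p.2])) //=.
exists (fun a => (thead a, [tuple of behead a])) => [[x a] _|a _] /=.
  by congr pair; apply: val_inj.
by rewrite [RHS]tuple_eta.
Qed.

End LinearIndependence.

Section RegularSequences.
Variables (A : comNzRingType) (N : lmodType A) (fs : seq A).
Implicit Types (x y : N) (i : nat).

Lemma in_seq_mul0 i : in_seq_mul fs i (0 : N).
Proof. by exists (fun=> 0); rewrite big1 // => j _; rewrite scaler0. Qed.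

Lemma in_seq_mulD i x y :
  in_seq_mul fs i x -> in_seq_mul fs i y -> in_seq_mul fs i (x + y).
Proof.
move=> [c ->] [c' ->]; exists (fun j => c j + c' j).
by rewrite -big_split; apply: eq_bigr => j _; rewrite scalerDr.
Qed.

Lemma in_seq_mul_sum i (I : Type) (r : seq I) (P : pred I) (F : I -> N) :
  (forall l, P l -> in_seq_mul fs i (F l)) ->
  in_seq_mul fs i (\sum_(l <- r | P l) F l).
Proof.
by move=> PF; apply: big_ind => //; [apply: in_seq_mul0 | apply: in_seq_mulD].
Qed.

Lemma in_seq_mulZ i a x : in_seq_mul fs i x -> in_seq_mul fs i (a *: x).
Proof.
move=> [c ->]; exists (fun j => a *: c j); rewrite scaler_sumr.
by apply: eq_bigr => j _; rewrite !scalerA mulrC.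
Qed.

Lemma in_seq_mul_widen i x : in_seq_mul fs i x -> in_seq_mul fs i.+1 x.
Proof.
move=> [c ->]; exists (fun j => if (j < i)%N then c j else 0).
rewrite big_ord_recr /= ltnn scaler0 addr0.
by apply: eq_bigr => j _; rewrite ltn_ord.
Qed.

Lemma in_seq_mul_gen i j x : (j < i)%N -> in_seq_mul fs i (fs`_j *: x).
Proof.
move=> ji; exists (fun l => if l == j then x else 0).
rewrite (bigD1 (Ordinal ji)) //= eqxx big1 ?addr0 // => l /negPf lj.
by rewrite -[_ == j]/(l == Ordinal ji) lj scaler0.
Qed.

Lemma regular_seq_cancel i j x : regular_seq N fs -> (i < size fs)%N ->
  in_seq_mul fs i (fs`_i ^+ j *: x) -> in_seq_mul fs i x.
Proof.
move=> [reg _] ifs; elim: j => [|j IHj]; first by rewrite expr0 scale1r.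
by rewrite exprS -scalerA => /(reg _ ifs).
Qed.

End RegularSequences.

Definition seq_monomial (A : comNzRingType) (fs : seq A) (a : seq nat) : A :=
  \prod_(p <- zip fs a) p.1 ^+ p.2.

Lemma seq_monomial_cons (A : comNzRingType) f (fs : seq A) i a :
  seq_monomial (f :: fs) (i :: a) = f ^+ i * seq_monomial fs a.
Proof. by rewrite /seq_monomial /= big_cons. Qed.

Lemma seq_monomial0s (A : comNzRingType) a : seq_monomial ([::] : seq A) a = 1.
Proof. by case: a => [|i a]; rewrite /seq_monomial /= big_nil. Qed.

Lemma seq_monomials0 (A : comNzRingType) (fs : seq A) :
  seq_monomial fs [::] = 1.
Proof. by case: fs => [|f fs]; rewrite /seq_monomial /= big_nil. Qed.

Lemma rmorph_seq_monomial (A B : comNzRingType) (g : {rmorphism A -> B}) fs a :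
  g (seq_monomial fs a) = seq_monomial (map g fs) a.
Proof.
elim: fs a => [|f fs IHfs] [|i a];
  rewrite ?seq_monomial0s ?seq_monomials0 ?rmorph1 //.
by rewrite [map _ _]/= !seq_monomial_cons rmorphM rmorphXn IHfs.
Qed.

(* A nontrivial relation is divided by the largest possible power of its first *)
(* variable and reduced modulo that variable; regularity permits both steps.   *)
Lemma regular_seq_lin_indep (K : fieldType) (A : comAlgType K) (N : lmodType A)
    (fs : seq A) k :
  regular_seq N fs -> forall c : (size fs).-tuple 'I_k -> K,
  (forall x : N, (\sum_a c a *: seq_monomial fs (map val a)) *: x = 0) ->
  forall a, c a = 0.
Proof.
move=> reg c c0.
(* Stronger claim for the induction: the relation involves only a suffix of the sequence and holds
   only modulo the prefix. *)
suff gen suf pre : fs = pre ++ suf -> forall c : (size suf).-tuple 'I_k -> K,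
    (forall x : N, in_seq_mul fs (size pre)
       ((\sum_a c a *: seq_monomial suf (map val a)) *: x)) ->
    forall a, c a = 0.
  by apply: (gen fs [::]) => // x; rewrite c0; apply: in_seq_mul0.
elim: suf pre {c c0} => [|f suf IHsuf] pre fsE c c0.
  (* No elements remain: a nonzero constant is invertible and would put all of [N] into (fs) N. *)
  move=> a; apply/eqP/negPn/negP => ca; have [_ [x []]] := reg.
  have := c0 ((c a)^-1%:A *: x).
  rewrite (big_pred1 a) => [|b]; last first.
    by apply/esym/eqP;
      rewrite (tuple0 (b : 0.-tuple _)) (tuple0 (a : 0.-tuple _)).
  rewrite seq_monomial0s scalerA -scalerAl mul1r scalerA mulfV //.
  by rewrite !scale1r fsE cats0.
have sz : (size pre < size fs)%N by rewrite fsE size_cat /= addnS ltnS leq_addr.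
have fE : fs`_(size pre) = f by rewrite fsE nth_cat ltnn subnn.
pose E i : A := \sum_(a : (size suf).-tuple 'I_k)
  c [tuple of i :: a] *: seq_monomial suf (map val a).
have cE : \sum_a c a *: seq_monomial (f :: suf) (map val a) =
    \sum_(i < k) f ^+ i * E i.
  rewrite big_tuple_cons; apply: eq_bigr => i _; rewrite mulr_sumr.
  by apply: eq_bigr => a _; rewrite seq_monomial_cons scalerAr.
suff main i (a : (size suf).-tuple 'I_k) : c [tuple of i :: a] = 0.
  by move=> a; rewrite [a]tuple_eta.
have [j] := ubnP (val i); elim: j i a => // j IHj i a ij.
apply: (IHsuf (rcons pre f) _ (fun a => c [tuple of i :: a])) => [|x].
  by rewrite cat_rcons.
rewrite size_rcons -/(E i).
(* [G] collects the exponents above [i]; those below vanish by induction. So [f ^+ i] can be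
   cancelled, and [f * G] disappears modulo [f]. *)
pose G := \sum_(l < k | (i < l)%N) f ^+ (l - i.+1) * E l.
have split : \sum_(l < k) f ^+ l * E l = f ^+ i * (E i + f * G).
  rewrite (bigID (fun l : 'I_k => (l < i)%N)) /= big1 ?add0r => [|l li].
    rewrite (bigD1 i) /= ?ltnn // mulrDr; congr (_ + _).
    rewrite /G !mulr_sumr; apply: eq_big => l.
      by rewrite -leqNgt ltn_neqAle andbC eq_sym.
    rewrite -leqNgt => /andP[il li].
    have {}il : (i < l)%N by rewrite ltn_neqAle eq_sym li.
    by rewrite !mulrA -exprSr -exprD subnKC.
  rewrite /E big1 ?mulr0 // => b _.
  by rewrite IHj ?scale0r //; apply: leq_trans li _; rewrite -ltnS.
have := c0 x; rewrite cE split -scalerA -{1}fE => /(regular_seq_cancel reg sz).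
move=> /in_seq_mul_widen EG.
have -> : E i *: x = (E i + f * G) *: x + (- 1) *: (f *: (G *: x)).
  by rewrite scalerDl -scalerA scaleN1r addrK.
apply: in_seq_mulD EG _; apply: in_seq_mulZ.
by rewrite -fE; apply: in_seq_mul_gen.
Qed.

Section DegreeBounds.
Variables (K : fieldType) (m : nat).
Implicit Types p q : {mpoly K[m]}.

Lemma msizeM_bound p q d e :
  (msize p <= d.+1)%N -> (msize q <= e.+1)%N -> (msize (p * q) <= (d + e).+1)%N.
Proof.
have [->|p0] := eqVneq p 0; first by rewrite mul0r msize0.
have [->|q0] := eqVneq q 0; first by rewrite mulr0 msize0.
by rewrite (msizeM p0 q0); move: (msize p) (msize q) => a b; lia.
Qed.

Lemma msizeX_bound p d k : (msize p <= d.+1)%N ->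
  (msize (p ^+ k) <= (k * d).+1)%N.
Proof.
move=> pd; elim: k => [|k IHk]; first by rewrite expr0 msize1.
by rewrite exprS mulSn msizeM_bound.
Qed.

Lemma msize_seq_monomial (gs : seq {mpoly K[m]}) (a : seq nat) d k :
  all (fun g => msize g <= d.+1)%N gs -> all (fun i => i <= k)%N a ->
  (msize (seq_monomial gs a) <= (size gs * (k * d)).+1)%N.
Proof.
elim: gs a => [|g gs IHgs] [|i a] //=;
  rewrite ?seq_monomial0s ?seq_monomials0 ?msize1 //.
rewrite seq_monomial_cons => /andP[gd gsd] /andP[ik ak].
rewrite mulSn; apply: msizeM_bound; last exact: IHgs.
by apply: leq_trans (msizeX_bound i gd) _; rewrite ltnS leq_mul2r ik orbT.
Qed.

Lemma card_bmultinom_leq E : (#|{: 'X_{1..m < E.+1}}| <= E.+1 ^ m)%N.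
Proof.
pose f (w : 'X_{1..m < E.+1}) : {ffun 'I_m -> 'I_E.+1} :=
  [ffun i => inord (w i)].
have f_inj : injective f.
  move=> w w' /ffunP ww'; apply/val_inj/mnmP => i.
  have lt (v : 'X_{1..m < E.+1}) : (v i < E.+1)%N.
    by apply: leq_ltn_trans (bmdeg v); rewrite mdegE (bigD1 i) //= leq_addr.
  by have := ww' i; rewrite !ffunE => /(congr1 val); rewrite /= !inordK.
by have := leq_card f f_inj; rewrite card_ffun !card_ord.
Qed.

End DegreeBounds.

(* If the length t exceeded m, the k ^ t monomials in fs with exponents below k *)
(* would be linearly independent polynomials in m variables of degree linear in *)
(* k, which is impossible for large k.                                          *)
Lemma regular_seq_size_leq (K : fieldType) (n m : nat) (S : comAlgType K)
    (g : {lrmorphism {mpoly K[n]} -> S})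
    (sigma : {lrmorphism {mpoly K[n]} -> {mpoly K[m]}})
    (psi : {mpoly K[m]} -> S) (fs : seq {mpoly K[n]}) :
  psi 0 = 0 -> (forall p, g p = psi (sigma p)) ->
  regular_seq (restrict_scalars g) fs -> (size fs <= m)%N.
Proof.
move=> psi0 gE reg; rewrite leqNgt; apply/negP => mt.
set t := size fs in mt *.
pose d := \max_(f <- fs) msize (sigma f).
pose C := (t * d).+1.
suff bound k : (0 < k -> k ^ t <= (k * C) ^ m)%N.
  (* For k = C^m + 1 and t > m one has k^t >= k^(m + 1) > k^m C^m. *)
  have := bound (C ^ m).+1 isT; apply/negP; rewrite -ltnNge.
  apply: (@leq_trans ((C ^ m).+1 ^ m.+1)); last by rewrite leq_pexp2l.
  by rewrite expnMn expnS mulnC ltn_pmul2r // expn_gt0.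
move=> k0; pose E := (t * (k * d))%N.
suff : (#|{: t.-tuple 'I_k}| <= #|{: 'X_{1..m < E.+1}}|)%N.
  rewrite card_tuple card_ord => /leq_trans; apply.
  apply: leq_trans (card_bmultinom_leq m E) _;
  have EC : (E.+1 <= k * C)%N by rewrite /E /C; nia.
  by have [->|m0] := posnP m; rewrite ?expn0 // leq_exp2r.
pose u (a : t.-tuple 'I_k) := sigma (seq_monomial fs (map val a)).
apply: (@lin_indep_leq K {mpoly K[m]} _ _ u
  (fun w : 'X_{1..m < E.+1} => 'X_[w]) (fun a w => (u a)@_w)).
  move=> a; apply: mpolywE; rewrite /u rmorph_seq_monomial.
  have -> : E = (size (map sigma fs) * (k * d))%N by rewrite size_map.
  apply: msize_seq_monomial.
    rewrite all_map; apply/allP => f ffs /=; apply: leqW.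
    by apply: (@leq_bigmax_seq _ fs xpredT (fun f => msize (sigma f))).
  by apply/allP => _ /mapP[i _ ->]; apply: (ltnW (ltn_ord i)).
(* A relation among the images under [sigma] gives a combination acting as zero on the module,
   because [g] factors through [sigma]. *)
move=> c c0; apply: (regular_seq_lin_indep reg) => x.
set p := \sum_a _; change (g p * (x : S) = 0).
have -> : g p = 0.
  rewrite gE linear_sum; under eq_bigr do rewrite linearZ.
  by rewrite c0.
by rewrite mul0r.
Qed.

(** * Graded retracts of polynomial rings *)

Section PolynomialMorphisms.
Variables (K : fieldType) (n : nat).

Lemma eq_lrmorph_mpoly (T : comAlgType K)
    (f g : {lrmorphism {mpoly K[n]} -> T}) :
  (forall i, f 'X_i = g 'X_i) -> f =1 g.
Proof.
move=> fg p; rewrite (mpolyE p) !linear_sum; apply: eq_bigr => w _.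
rewrite !linearZ; congr (_ *: _); rewrite mpolyXE_id !rmorph_prod.
by apply: eq_bigr => i _; rewrite !rmorphXn; congr (_ ^+ _); apply: fg.
Qed.

Lemma dhomog1E (p : {mpoly K[n]}) :
  p \is 1.-homog -> p = \sum_i p@_U_(i) *: 'X_i.
Proof.
move=> p1; apply/mpolyP => w; rewrite linear_sum /=.
under eq_bigr do rewrite linearZ /= mcoeffX.
have [/mdeg1P[i /eqP ->]|w1] := boolP (mdeg w == 1%N).
  rewrite (bigD1 i) //= eqxx mulr1 big1 ?addr0 // => j /negPf ji.
  by rewrite eq_mnm1 ji mulr0.
rewrite (dhomog_nemf_coeff p1) // big1 // => j _.
case: eqP => [wj|_]; last by rewrite mulr0.
by rewrite -wj mdeg1 in w1.
Qed.

End PolynomialMorphisms.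

Section Retracts.
Variables (K : fieldType) (n : nat) (S : graded_retract K n).

(** Matrix of the idempotent R -> S -> R on linear forms; its rank is the dimension of S_1. *)
Definition retract_mx : 'M[K]_n :=
  \matrix_(i, j) (retr_incl S (retr_proj S 'X_i))@_U_(j).

Lemma retract_mxE i :
  retr_incl S (retr_proj S 'X_i) = \sum_j retract_mx i j *: 'X_j.
Proof.
have h : retr_incl S (retr_proj S 'X_i) \is 1.-homog.
  apply: (@retr_incl_comp _ _ S 1); apply: (@retr_proj_comp _ _ S 1).
  by rewrite /= dhomogX /= mdeg1.
by rewrite [LHS]dhomog1E //; apply: eq_bigr => j _; rewrite mxE.
Qed.

Definition mx_linear_forms m (M : 'M[K]_(m, n)) (i : 'I_m) : {mpoly K[n]} :=
  \sum_j M i j *: 'X_j.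

Lemma retract_linear_forms m (M : 'M[K]_(m, n)) i :
  retr_incl S (retr_proj S (mx_linear_forms M i)) =
  mx_linear_forms (M *m retract_mx) i.
Proof.
rewrite /mx_linear_forms !linear_sum.
under eq_bigr do rewrite !linearZ /= retract_mxE scaler_sumr.
rewrite exchange_big; apply: eq_bigr => j _.
rewrite mxE scaler_suml; apply: eq_bigr => l _.
by rewrite scalerA.
Qed.

Lemma mx_linear_forms_inj m (M M' : 'M[K]_(m, n)) :
  mx_linear_forms M =1 mx_linear_forms M' -> M = M'.
Proof.
have coefE (N : 'M[K]_(m, n)) i j : (mx_linear_forms N i)@_U_(j) = N i j.
  rewrite linear_sum (bigD1 j) //= linearZ /= mcoeffXU eqxx mulr1.
  rewrite big1 ?addr0 // => l /negPf lj.
  by rewrite linearZ /= mcoeffXU lj mulr0.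
by move=> MM'; apply/matrixP => i j; rewrite -!coefE MM'.
Qed.

Lemma retract_mx_idem : retract_mx *m retract_mx = retract_mx.
Proof.
apply: mx_linear_forms_inj => i; rewrite -retract_linear_forms.
by rewrite /mx_linear_forms -retract_mxE retr_inclK.
Qed.

Local Notation r := (\rank retract_mx).
Local Notation b := (mx_linear_forms (row_base retract_mx)).

Lemma retract_row_baseK l : retr_incl S (retr_proj S (b l)) = b l.
Proof.
rewrite retract_linear_forms; congr (mx_linear_forms _ l).
have /submxP[D ->] : (row_base retract_mx <= retract_mx)%MS.
  by rewrite eq_row_base.
by rewrite -mulmxA retract_mx_idem.
Qed.

(** The linear forms given by a row base are fixed by the idempotent, hence recovered from their
    projections to [S]; so these are independent too. *)
Lemma retract_degree1 : exists u : 'I_r -> S,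
  (forall l, retr_comp 1 (u l)) /\
  forall c : 'I_r -> K, \sum_l c l *: u l = 0 -> forall l, c l = 0.
Proof.
exists (fun l => retr_proj S (b l)); split=> [l|c c0 l].
  apply: (@retr_proj_comp _ _ S 1); rewrite /= rpred_sum // => j _.
  by rewrite rpredZ // dhomogX /= mdeg1.
suff /rowP/(_ l) : \row_l c l = 0 by rewrite !mxE.
apply: (row_free_inj (row_base_free retract_mx)).
apply: mx_linear_forms_inj => i; rewrite mul0mx.
have -> : mx_linear_forms 0 i = retr_incl S (\sum_l c l *: retr_proj S (b l)).
  by rewrite c0 rmorph0 /mx_linear_forms big1 // => j _; rewrite mxE scale0r.
rewrite linear_sum; under [RHS]eq_bigr do rewrite linearZ /= retract_row_baseK.
rewrite /mx_linear_forms; under [RHS]eq_bigr do rewrite scaler_sumr.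
rewrite exchange_big; apply: eq_bigr => j _; rewrite !mxE scaler_suml.
by apply: eq_bigr => k _; rewrite scalerA mxE.
Qed.

(** The rank factorization of [retract_mx] makes the idempotent, and with it the projection to [S],
    factor through a polynomial ring in [r] variables. *)
Lemma retract_regular_seq_size fs :
  regular_seq (retr_module S) fs -> (size fs <= r)%N.
Proof.
pose M := col_base retract_mx.
pose tM := [tuple \sum_l M i l *: 'X_l | i < n] : n.-tuple {mpoly K[r]}.
pose tb := [tuple b l | l < r].
pose sigma : {lrmorphism {mpoly K[n]} -> {mpoly K[r]}} := comp_mpoly tM.
pose psi' : {lrmorphism {mpoly K[r]} -> {mpoly K[n]}} := comp_mpoly tb.
apply: (@regular_seq_size_leq _ _ _ _ (retr_proj S) sigma
  (fun p => retr_proj S (psi' p))) => [|p]; first by rewrite !rmorph0.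
rewrite -[LHS]retr_inclK; congr (retr_proj S _).
pose f : {lrmorphism {mpoly K[n]} -> {mpoly K[n]}} :=
  retr_incl S \o retr_proj S.
pose g : {lrmorphism {mpoly K[n]} -> {mpoly K[n]}} := (psi' \o sigma).
apply: (@eq_lrmorph_mpoly _ _ _ f g) => i.
rewrite /f /g /= retract_mxE comp_mpolyXU (nth_map i) ?size_enum_ord //.
rewrite nth_ord_enum linear_sum /=.
under [RHS]eq_bigr do rewrite
  linearZ /= comp_mpolyXU -tnth_nth tnth_mktuple scaler_sumr.
rewrite exchange_big; apply: eq_bigr => j _.
rewrite -{1}(mulmx_base retract_mx) mxE scaler_suml.
by apply: eq_bigr => l _; rewrite scalerA.
Qed.

(* The existence of a maximal length is obtained by descending induction, in   *)
(* order to avoid excluded middle.                                             *)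
Lemma leq_depth_rank d :
  (forall d', is_depth (retr_module S) d' -> (d <= d')%N) -> (d <= r)%N.
Proof.
move=> dmin; rewrite leqNgt; apply/negP => rd.
have none j : (j <= r.+1)%N -> ~ exists fs : seq {mpoly K[n]},
    [/\ {in fs, forall f, irrelevant_ideal f},
        regular_seq (retr_module S) fs & (r.+1 - j <= size fs)%N].
  elim: j => [|j IHj] jr [fs [fsI reg sz]].
    have := retract_regular_seq_size reg; rewrite leqNgt => /negP; apply.
    by rewrite subn0 in sz.
  have bounded fs' : {in fs', forall f, irrelevant_ideal f} ->
      regular_seq (retr_module S) fs' -> (size fs' <= r - j)%N.
    move=> fsI' reg'; rewrite leqNgt; apply/negP => lt.
    by apply: IHj (ltnW jr) _; exists fs'; split=> //; rewrite subSn.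
  have szE : size fs = (r - j)%N.
    by apply/eqP; rewrite eqn_leq bounded //; rewrite subSS in sz.
  (* A regular sequence of length r - j with no longer one realises the depth, which would then be
     smaller than [d]. *)
  have /dmin : is_depth (retr_module S) (r - j).
    by split=> //; exists fs; split.
  by move=> /(leq_trans rd); rewrite ltnNge leq_subr.
(* The empty sequence contradicts the last case; it is regular because [S] is nonzero. *)
apply: (none r.+1 (leqnn _)); exists [::]; split=> //.
  split=> //; exists (1 : S) => -[c]; rewrite big_ord0 => /eqP.
  by apply/negP; apply: (@oner_neq0 S).
by rewrite subnn.
Qed.

End Retracts.

(** * Monomials of the squarefree Veronese ideal *)

Section Monomials.
Variable n : nat.
Implicit Type w : 'X_{1..n}.

Definition monomials k : seq 'X_{1..n} :=
  [seq Multinom t | t <- pmap insub (compositions n k)].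

Lemma monomialsE k : [seq (w : seq nat) | w <- monomials k] = compositions n k.
Proof.
rewrite -map_comp /=; set h := map _ _.
have -> : h = [seq val t | t : n.-tuple nat <- pmap insub (compositions n k)]
  by [].
rewrite (pmap_filter (insubK _)); apply/all_filterP/allP => c.
by rewrite mem_compositions isSome_insub => /andP[].
Qed.

Lemma multinom_seq_inj : injective (fun w => (w : seq nat)).
Proof. by move=> [t] [t'] /= /val_inj ->. Qed.

Lemma monomials_uniq k : uniq (monomials k).
Proof.
apply: (@map_uniq _ _ (fun w => (w : seq nat))).
by rewrite monomialsE compositions_uniq.
Qed.

Lemma mem_monomials k w : (w \in monomials k) = (mdeg w == k).
Proof.
rewrite -(mem_map multinom_seq_inj) monomialsE mem_compositions size_tuple eqxx.
by rewrite /mdeg sumnE.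
Qed.

Lemma count_monomials k s :
  count (fun w => nnz w == s) (monomials k) =
    ('C(n, s) * pos_compositions_card s k)%N.
Proof. by rewrite -count_compositions -monomialsE count_map. Qed.

Lemma nnzE w : nnz w = #|[pred i | w i != 0%N]|.
Proof.
have wE : (w : seq nat) = [seq w i | i <- enum 'I_n].
  apply: (@eq_from_nth _ 0%N) => [|i];
    first by rewrite size_map size_enum_ord size_tuple.
  rewrite size_tuple => lt_in;
    rewrite (nth_map (Ordinal lt_in)) ?size_enum_ord //.
  by rewrite (mnm_nth 0%N) nth_enum_ord.
rewrite wE /nnz count_map enumT cardE /enum_mem size_filter.
by apply: eq_count => i.
Qed.

Lemma nnz_leq_mdeg w : (nnz w <= mdeg w)%N.
Proof.
rewrite nnzE -sum1_card mdegE big_mkcond; apply: leq_sum => i _ /=.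
by rewrite inE; case: (w i).
Qed.

Lemma nnz_mono w w' : (w <= w')%MM -> (nnz w <= nnz w')%N.
Proof.
move=> /mnm_lepP ww'; rewrite !nnzE; apply/subset_leq_card/subsetP => i.
by rewrite !inE -!lt0n => /leq_trans; apply.
Qed.

Lemma nnz_squarefree w : (forall i, (w i <= 1)%N) -> nnz w = mdeg w.
Proof.
move=> w1; rewrite nnzE -sum1_card mdegE big_mkcond; apply: eq_bigr => i _ /=.
by rewrite inE; have := w1 i; case: (w i) => [|[]].
Qed.

Lemma squarefree_divisor w d : (d <= nnz w)%N ->
  exists w' : 'X_{1..n},
    [/\ (w' <= w)%MM, forall i, (w' i <= 1)%N & mdeg w' = d].
Proof.
rewrite nnzE cardE => dw; pose s := take d (enum [pred i | w i != 0%N]).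
exists (mesym1 [set i in s]); split=> [|i|].
- apply/mnm_lepP => i; rewrite mnmE inE.
  case: (boolP (i \in s)) => // /mem_take.
  by rewrite mem_enum inE lt0n.
- by rewrite mnmE; case: (_ \in _).
rewrite mdeg_mesym1 cardsE -(size_takel dw); apply/card_uniqP.
by rewrite take_uniq ?enum_uniq.
Qed.

Definition veronese_monomials d k :=
  [seq w : 'X_{1..n} <- monomials k | (d <= nnz w)%N].

Lemma size_veronese_monomials d k : size (veronese_monomials d k) =
  (\sum_(d <= s < n.+1) 'C(n, s) * pos_compositions_card s k)%N.
Proof.
under eq_bigr do rewrite -count_monomials.
rewrite size_filter.
under eq_bigr do rewrite -sum1_count big_mkcond /=.
rewrite exchange_big -sum1_count big_mkcond /=; apply: eq_bigr => w _.
rewrite -big_mkcond /= (eq_bigl (pred1 (nnz w))) => [|s];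
  last by rewrite eq_sym.
have wn : (nnz w < n.+1)%N by rewrite ltnS nnzE -[leqRHS]card_ord max_card.
case: leqP => dw.
  by rewrite -big_filter filter_pred1_uniq ?iota_uniq ?mem_index_iota ?dw //
    big_seq1.
rewrite -big_filter (_ : filter _ _ = [::]) ?big_nil //.
apply/eqP; rewrite -[_ == _]negbK -has_filter; apply/hasP => -[s].
by rewrite mem_index_iota => /andP[ds _] /= /eqP sw; rewrite sw leqNgt dw in ds.
Qed.

End Monomials.

Section IdealMembership.
Variables (K : fieldType) (n d : nat).
Implicit Type f : {mpoly K[n]}.

(** The ideal is spanned by monomials, and a monomial has a squarefree divisor of degree [d] exactly
    when at least [d] variables occur in it. *)
Lemma squarefree_veroneseP f :
  squarefree_veronese d f <->
  {in msupp f, forall w : 'X_{1..n}, (d <= nnz w)%N}.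
Proof.
split=> [[s [sG ->]] w|fd].
  rewrite mcoeff_msupp leqNgt; apply: contraNN => wd.
  rewrite linear_sum big_seq big1 // => p /sG[w' [w'1 dw' p2]].
  apply/eqP; rewrite mcoeff_eq0 p2;
    apply/negP => /msuppM_le/allpairsP[[u v]] /=.
  rewrite msuppX inE => -[_ /eqP -> wE].
  have := nnz_mono (lem_addl u w'); rewrite -wE nnz_squarefree // dw' leqNgt.
  by move=> /negP; apply.
rewrite (mpolyE f) big_seq; apply: (big_ind (@squarefree_veronese K n d)).
- by exists [::]; rewrite big_nil.
- move=> _ _ [s [sG ->]] [s' [sG' ->]]; exists (s ++ s'); rewrite big_cat.
  by split=> // p; rewrite mem_cat => /orP[/sG|/sG'].
move=> w /fd /squarefree_divisor[w' [ww' w'1 dw']].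
exists [:: (f@_w *: 'X_[w - w'], 'X_[w'])]; rewrite big_seq1 /=.
split=> [p|]; last by rewrite -scalerAl -mpolyXD submK.
by rewrite inE => /eqP ->; exists w'.
Qed.

End IdealMembership.

Section Dimension.
Variables (K : fieldType) (n : nat).

Lemma mpoly_expand_in (L : seq 'X_{1..n}) (f : {mpoly K[n]}) :
  uniq L -> {subset msupp f <= L} ->
  f = \sum_(i < size L) f@_(nth 0%MM L i) *: 'X_[nth 0%MM L i].
Proof.
move=> Lu fL; rewrite
  -(big_mkord xpredT (fun i => f@_(nth 0%MM L i) *: 'X_[nth 0%MM L i])).
rewrite -(big_nth 0%MM xpredT (fun w => f@_w *: 'X_[w])) {1}(mpolyE f).
rewrite [RHS](bigID (fun w => w \in msupp f)) /=.
rewrite [X in _ + X]big1 ?addr0 => [|w]; last first.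
  by move=> /memN_msupp_eq0 ->; rewrite scale0r.
rewrite -[RHS]big_filter; apply/perm_big/uniq_perm;
  rewrite ?msupp_uniq ?filter_uniq //.
by move=> w; rewrite mem_filter; case: (boolP (w \in msupp f)) => // /fL ->.
Qed.

Lemma has_dim_monomials (P : {mpoly K[n]} -> Prop) (L : seq 'X_{1..n}) :
  uniq L -> (forall f, P f <-> {subset msupp f <= L}) -> has_dim P (size L).
Proof.
move=> Lu PE; split.
  split=> [|a f g /PE fL /PE gL]; first by apply/PE; rewrite msupp0.
  by apply/PE => w /msuppD_le; rewrite mem_cat => /orP[/msuppZ_le/fL|/gL].
have nth_inL (i : 'I_(size L)) : nth 0%MM L i \in L by apply: mem_nth.
exists (fun i => 'X_[nth 0%MM L i]); split=> [i|f /PE fL].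
  by apply/PE => w; rewrite msuppX inE => /eqP ->.
have coefE (c : {ffun 'I_(size L) -> K}) (j : 'I_(size L)) :
    (\sum_i c i *: 'X_[nth 0%MM L i] : {mpoly K[n]})@_(nth 0%MM L j) = c j.
  rewrite linear_sum (bigD1 j) //= linearZ /= mcoeffX eqxx mulr1.
  rewrite big1 ?addr0 // => i ij; rewrite linearZ /= mcoeffX nth_uniq //.
  by rewrite -[_ == _ :> nat]/(i == j) (negPf ij) mulr0.
exists [ffun i : 'I_(size L) => f@_(nth 0%MM L i)]; split=> [|c fE].
  by under eq_bigr do rewrite ffunE; apply: mpoly_expand_in.
by apply/ffunP => i; rewrite ffunE fE coefE.
Qed.

End Dimension.

Lemma fps_1subT_pow_neg n d i k : (0 < d)%N -> (i < n)%N ->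
  fps_1subT_pow (- n%:Z + i%:Z - d%:Z + 1) k =
  'C(k + (n - i.+1 + d.-1), n - i.+1 + d.-1)%:Z.
Proof.
move=> d_gt0 lt_in; have -> : - n%:Z + i%:Z - d%:Z + 1 = Negz (n - i.+1 + d.-1).
  by rewrite NegzE; lia.
exact: fps_exp_geom.
Qed.

Section HilbertSeries.
Variables (n d : nat).
Hypotheses (d_gt0 : (0 < d)%N) (dn : (d <= n)%N).

Lemma veronese_hilbert_seriesE k :
  \sum_(d.-1 <= i < n) 'C(i, d.-1)%:Z *
     laurent_shift d (fps_1subT_pow (- n%:Z + i%:Z - d%:Z + 1)) k =
  if k is Posz j then (size (veronese_monomials n d j))%:Z else 0.
Proof.
case: k => j; last first.
  rewrite big1 // => i _; rewrite /laurent_shift.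
  have -> : Negz j - d%:Z = Negz (j + d) by rewrite !NegzE; lia.
  by rewrite mulr0.
rewrite size_veronese_monomials.
case: j => [|j].
  rewrite !big_nat !big1 // => i /andP[di _].
    by case: i di => [|i]; rewrite ?muln0 //; lia.
  rewrite /laurent_shift.
  have -> : 0%:Z - d%:Z = Negz d.-1 by rewrite NegzE; lia.
  by rewrite mulr0.
case: d d_gt0 dn => // e _ en /=.
(* Terms with i < e vanish through C(i, e). If j < e, the second binomial vanishes, in accordance
   with [laurent_shift]. *)
transitivity (\sum_(0 <= i < n)
  ('C(i, e) * 'C(j + (n - i.+1), n - i.+1 + e))%N%:Z).
  rewrite [RHS](big_cat_nat _ (n := e)) //=; last exact: ltnW.
  rewrite [X in X + _]big_nat [X in X + _]big1 ?add0r => [|i /andP[_ ie]];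
    last first.
    by rewrite bin_small.
  apply: eq_big_nat => i /andP[ei lt_in]; rewrite PoszM; congr (_ * _).
  rewrite /laurent_shift; have [ej|je] := leqP e j.
    have -> : j.+1%:Z - e.+1%:Z = Posz (j - e) by lia.
    rewrite fps_1subT_pow_neg //=.
    by congr (Posz 'C(_, _)); lia.
  have -> : j.+1%:Z - e.+1%:Z = Negz (e - j.+1) by rewrite NegzE; lia.
  by rewrite bin_small //; lia.
rewrite -(big_morph Posz PoszD (erefl _)); congr Posz.
transitivity (\sum_(0 <= i < n) 'C(n - i.+1, e) * 'C(j + i, i + e))%N.
  rewrite big_nat_rev; apply: eq_big_nat => i /andP[_ lt_in]; rewrite add0n.
  by congr (_ * 'C(_, _))%N; lia.
rewrite -sum_support_eq; last by lia.
by apply: eq_big_nat => -[|s].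
Qed.

Lemma size_veronese_monomials_d : size (veronese_monomials n d d) = 'C(n, d).
Proof.
rewrite size_veronese_monomials big_ltn // big_nat big1 => [|s /andP[ds _]].
  by rewrite addn0; case: d d_gt0 => // e _; rewrite /= binn muln1.
case: s ds => // s ds; case: d d_gt0 ds => // e _ es /=.
by rewrite (@bin_small e s es) muln0.
Qed.

(** Such a monomial either has a support of size [d] with one variable squared, or is squarefree. *)
Lemma size_veronese_monomials_dS :
  size (veronese_monomials n d d.+1) = (d * 'C(n, d) + 'C(n, d.+1))%N.
Proof.
rewrite size_veronese_monomials big_ltn //.
have -> : pos_compositions_card d d.+1 = d.
  by case: d d_gt0 => // e _ /=; rewrite binSn.
rewrite mulnC; congr addn; have [nd|nd] := leqP n d.
  by rewrite big_geq // bin_small.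
rewrite big_ltn // big_nat big1 /= ?binn ?muln1 ?addn0 // => s /andP[ds _].
by case: s ds => // s ds; rewrite /= (@bin_small d s ds) muln0.
Qed.

End HilbertSeries.

(** * Polynomial rings in fewer variables as graded retracts *)

Section Homogeneity.
Variables (K : fieldType) (n : nat).

Lemma mpoly_comp0 k : mpoly_comp k (0 : {mpoly K[n]}).
Proof. by case: k => k //=; apply: dhomog0. Qed.

Lemma mpoly_comp_subspace k : is_subspace (@mpoly_comp K n k).
Proof.
split=> [|a u v]; first exact: mpoly_comp0.
case: k => k /= uk vk; first by rewrite rpredD // rpredZ.
by rewrite uk vk scaler0 addr0.
Qed.

Lemma mpoly_comp_msupp k (f : {mpoly K[n]}) w :
  mpoly_comp k f -> w \in msupp f -> (mdeg w)%:Z = k.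
Proof.
case: k => k /=; first by move=> /dhomog_mf fk /fk ->.
by move=> ->; rewrite msupp0.
Qed.

Lemma mpoly_comp_grading : is_grading (@mpoly_comp K n).
Proof.
split=> [k|f|s c s_uniq cG c0 k ks]; first exact: mpoly_comp_subspace.
  exists [seq Posz j | j <- iota 0 (msize f)].
  exists (fun k => if k is Posz j then pihomog mdeg j f else 0); split.
    by case=> k //=; apply: pihomogP.
  rewrite big_map -[X in iota _ X]subn0 -/(index_iota 0 _) big_mkord.
  exact: pihomog_partitionE.
apply/mpolyP => w; rewrite mcoeff0.
have [wk|wk] := eqVneq (mdeg w)%:Z k; last first.
  apply/eqP; rewrite mcoeff_eq0; apply/negP => /(mpoly_comp_msupp (cG k)) E.
  by rewrite E eqxx in wk.
have := congr1 (mcoeff w) c0; rewrite mcoeff0 linear_sum (bigD1_seq k) //=.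
rewrite big1 ?addr0 // => j jk; apply/eqP; rewrite mcoeff_eq0; apply/negP.
by move=> /(mpoly_comp_msupp (cG j)) wj; rewrite -wj wk eqxx in jk.
Qed.

Lemma mpoly_comp1 : mpoly_comp 0 (1 : {mpoly K[n]}).
Proof. exact: dhomog1. Qed.

Lemma mpoly_compM j k (f g : {mpoly K[n]}) :
  mpoly_comp j f -> mpoly_comp k g -> mpoly_comp (j + k) (f * g).
Proof.
case: j => j /=; last by move=> -> _; rewrite mul0r; apply: mpoly_comp0.
case: k => k /=; last by move=> _ ->; rewrite mulr0; apply: mpoly_comp0.
exact: dhomogM.
Qed.

Lemma comp_mpoly_homog m (lq : n.-tuple {mpoly K[m]}) k (f : {mpoly K[n]}) :
  (forall i, tnth lq i \is 1.-homog) -> mpoly_comp k f ->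
    mpoly_comp k (f \mPo lq).
Proof.
move=> lq1; case: k => k /=; last by move=> ->; rewrite comp_mpoly0.
move=> /dhomog_mf fk; rewrite comp_mpolyE big_seq rpred_sum // => w /fk /= <-.
rewrite rpredZ // mdegE.
apply: (big_ind2 (fun (p : {mpoly K[m]}) d => p \is d.-homog)).
- exact: dhomog1.
- by move=> p d q e; apply: dhomogM.
by move=> i _; rewrite -[X in X.-homog]mul1n; apply: dhomogMn.
Qed.

End Homogeneity.

Section PolynomialRetract.
Variables (K : fieldType) (n p : nat).
Hypothesis pn : (p <= n)%N.

Local Notation S := {mpoly K[p]}.
Local Notation R := {mpoly K[n]}.

Definition incl_vars : p.-tuple R := [tuple 'X_(widen_ord pn i) | i < p].
Definition proj_vars : n.-tuple S :=
  [tuple (if insub (val i) is Some j then 'X_j else 0) | i < n].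

Definition poly_incl : {lrmorphism S -> R} := comp_mpoly incl_vars.
Definition poly_proj : {lrmorphism R -> S} := comp_mpoly proj_vars.

Lemma poly_inclX i : poly_incl 'X_i = 'X_(widen_ord pn i).
Proof. by rewrite /poly_incl /= comp_mpolyXU -tnth_nth tnth_mktuple. Qed.

Lemma poly_projX i : poly_proj 'X_(widen_ord pn i) = 'X_i.
Proof.
rewrite /poly_proj /= comp_mpolyXU -tnth_nth tnth_mktuple /=.
by case: insubP => [j _ ji|]; rewrite ?ltn_ord //; congr 'X_ _; apply: val_inj.
Qed.

Lemma poly_inclK : cancel poly_incl poly_proj.
Proof.
pose f : {lrmorphism S -> S} := poly_proj \o poly_incl.
pose g : {lrmorphism S -> S} := idfun.
apply: (@eq_lrmorph_mpoly _ _ _ f g) => i.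
by rewrite /f /g /= -/(poly_incl _) poly_inclX poly_projX.
Qed.

Lemma poly_incl_comp k x : mpoly_comp k x -> mpoly_comp k (poly_incl x).
Proof.
by apply: comp_mpoly_homog => i; rewrite tnth_mktuple dhomogX /= mdeg1.
Qed.

Lemma poly_proj_comp k x : mpoly_comp k x -> mpoly_comp k (poly_proj x).
Proof.
apply: comp_mpoly_homog => i; rewrite tnth_mktuple.
by case: insubP => [j _ _|_]; rewrite ?dhomogX /= ?mdeg1 // dhomog0.
Qed.

Definition poly_retract : graded_retract K n :=
  GradedRetract (mpoly_comp_grading K p) (mpoly_comp1 K p)
    (@mpoly_compM K p) poly_incl_comp poly_proj_comp poly_inclK.

Definition retract_vars : seq R := [seq 'X_(widen_ord pn i) | i <- enum 'I_p].

Lemma retract_vars_nth i (ip : (i < p)%N) :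
  retract_vars`_i = 'X_(widen_ord pn (Ordinal ip)).
Proof.
rewrite (nth_map (Ordinal ip)) ?size_enum_ord //.
by congr 'X_(widen_ord _ _); apply: val_inj; rewrite /= nth_enum_ord.
Qed.

Local Notation N := (retr_module poly_retract).

Lemma retract_vars_scale i (ip : (i < p)%N) (x : N) :
  retract_vars`_i *: x = 'X_(Ordinal ip) * (x : S) :> S.
Proof. by rewrite retract_vars_nth -[RHS]/(_ * _) -poly_projX. Qed.

Lemma mcoeffXM_eq0 m j (q : {mpoly K[m]}) (w : 'X_{1..m}) :
  w j = 0%N -> ('X_j * q)@_w = 0.
Proof.
move=> wj; apply/eqP; rewrite mcoeff_eq0; apply/negP => /msuppM_le/allpairsP.
move=> [[u v]] /=; rewrite msuppX inE => -[/eqP-> _ wE].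
by rewrite wE mnmDE mnm1E eqxx in wj.
Qed.

(** The first [i] variables generate a monomial ideal, so regularity becomes a question about
    supports. *)
Lemma in_seq_mul_varsP i (x : N) : (i <= p)%N ->
  in_seq_mul retract_vars i x <->
  {in msupp (x : S), forall w : 'X_{1..p},
    exists2 j : 'I_p, (j < i)%N & w j != 0%N}.
Proof.
move=> ip; split=> [[c xE] w|xw].
  rewrite mcoeff_msupp => xw0; apply/exists_inP; apply: contraNT xw0.
  rewrite negb_exists_in => /forall_inP wi; rewrite xE.
  apply/eqP; rewrite (@linear_sum K S K^o) big1 // => j _.
  have jp : (j < p)%N by apply: leq_trans (ltn_ord j) ip.
  change ((retract_vars`_j *: c j : S)@_w = 0).
  rewrite (retract_vars_scale jp) mcoeffXM_eq0 //; apply/eqP/negPn.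
  exact: (wi (Ordinal jp) (ltn_ord j)).
have xE : x = \sum_(w <- msupp (x : S) | w \in msupp (x : S))
    ((x : S)@_w *: 'X_[w] : S) :> S.
  by rewrite -big_seq -mpolyE.
rewrite [x]xE; apply: (@in_seq_mul_sum _ N) => w /xw[j ji wj].
pose y : S := (x : S)@_w *: 'X_[w - U_(j)].
have yE : retract_vars`_j *: (y : N) = ((x : S)@_w *: 'X_[w] : S) :> S.
  rewrite (retract_vars_scale (ltn_ord j)) /y -scalerAr -mpolyXD.
  by rewrite (_ : Ordinal _ = j) 1?addmC ?submK ?lep1mP //; apply: val_inj.
by move: (@in_seq_mul_gen _ N retract_vars i j y ji); rewrite yE.
Qed.

Lemma size_retract_vars : size retract_vars = p.
Proof. by rewrite size_map size_enum_ord. Qed.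

(** Multiplication by a variable does not change the exponents of the earlier variables. *)
Lemma retract_vars_regular : regular_seq N retract_vars.
Proof.
rewrite /regular_seq size_retract_vars; split=> [i ip x|].
  move=> /(in_seq_mul_varsP _ (ltnW ip)) h.
  apply/(in_seq_mul_varsP _ (ltnW ip)) => w wx.
  have /h[j ji] : (U_(Ordinal ip) + w)%MM \in msupp (retract_vars`_i *: x : S).
    by rewrite (retract_vars_scale ip) mcoeff_msupp mulrC mcoeffMX
      -mcoeff_msupp.
  rewrite mnmDE mnm1E (_ : (Ordinal ip == j) = false) ?add0n; first by exists j.
  by apply/negP => /eqP ij; rewrite -ij /= ltnn in ji.
exists (1 : S) => /(in_seq_mul_varsP _ (leqnn p))/(_ 0%MM).
by rewrite msupp1 inE eqxx => /(_ isT)[j _]; rewrite mnm0E.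
Qed.

Lemma poly_retract_depth : is_depth (retr_module poly_retract) p.
Proof.
split=> [|fs _ reg].
  exists retract_vars; split; last exact: size_retract_vars.
    move=> _ /mapP[i _ ->]; exists [:: (1, 'X_(widen_ord pn i))].
    rewrite big_seq1 mul1r; split=> // q; rewrite inE => /eqP -> /=.
    by exists (widen_ord pn i).
  exact: retract_vars_regular.
by apply: (@regular_seq_size_leq _ _ _ _ poly_proj poly_proj id) reg.
Qed.

End PolynomialRetract.

(** * The upper bound *)

Section UpperBound.
Variables (K : fieldType) (n d : nat).
Local Notation R := {mpoly K[n]}.
Local Notation M := (@squarefree_veronese K n d).
Local Notation G := (@mpoly_comp K n).

Lemma squarefree_veronese_compP k f : M f /\ G k%:Z f <->
  {subset msupp f <= veronese_monomials n d k}.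
Proof.
split=> [[/squarefree_veroneseP Mf Gf] w wf|fL].
  rewrite mem_filter Mf //= mem_monomials -eqz_nat.
  by rewrite (mpoly_comp_msupp Gf wf).
split; first by apply/squarefree_veroneseP => w /fL;
  rewrite mem_filter => /andP[].
apply/dhomogP => w /fL; rewrite mem_filter mem_monomials => /andP[_ /eqP].
by [].
Qed.

Variables (m : nat) (S : 'I_m -> graded_retract K n) (s : 'I_m -> int).
Variable phi : forall i, {linear S i -> R}.
Hypothesis phi_comp : forall i k (x : S i),
  retr_comp k x -> G (k + s i) (phi i x).
Hypothesis phi_img : forall v,
  M v <-> exists x : forall i, S i, v = \sum_i phi i (x i).
Hypothesis phi_inj : forall x : forall i, S i,
  \sum_i phi i (x i) = 0 -> forall i, x i = 0.

(** The algebras [S i] are different types, so the family concentrated at [j] is written with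
    Kronecker scalars. *)
Lemma phi_single j (u : forall i, S i) :
  \sum_i phi i ((i == j)%:R *: u i) = phi j (u j).
Proof.
rewrite (bigD1 j) //= eqxx scale1r big1 ?addr0 // => i /negPf ->.
by rewrite scale0r linear0.
Qed.

Lemma phi_in_img j (u : forall i, S i) : M (phi j (u j)).
Proof.
by apply/phi_img; exists (fun i => (i == j)%:R *: u i); rewrite phi_single.
Qed.

Lemma phi1_neq0 j : phi j 1 != 0.
Proof.
apply/eqP => phi0; have := phi_inj (x := fun i => (i == j)%:R *: 1).
rewrite (phi_single j (fun i => 1)) phi0 => /(_ erefl j)/eqP.
by rewrite eqxx scale1r oner_eq0.
Qed.

Lemma phi1_comp j : G (s j) (phi j 1).
Proof. by rewrite -[s j]add0r; apply: phi_comp; apply: retr_comp1. Qed.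

(** The generator [phi j 1] is a nonzero homogeneous element of degree [s j] in the ideal, which
    starts in degree [d]. *)
Lemma shift_ge_d j : d%:Z <= s j.
Proof.
have : msupp (phi j 1) != [::] by rewrite msupp_eq0 phi1_neq0.
case E : (msupp (phi j 1)) => [//|w l] _.
have wI : w \in msupp (phi j 1) by rewrite E mem_head.
have /squarefree_veroneseP/(_ w wI) dw := phi_in_img j (fun i => 1).
rewrite -(mpoly_comp_msupp (phi1_comp j) wI) lez_nat.
exact: leq_trans dw (nnz_leq_mdeg w).
Qed.

(** [S i] is spanned by images of monomials, so it lives in degrees >= 0 with only constants in
    degree 0. As shifts are at least [d], only constants of summands with shift exactly [d] reach
    degree [d]. *)
Lemma pihomog_phi i (x : S i) : exists a : K,
  pihomog mdeg d (phi i x) = (a *+ (s i == d%:Z)) *: phi i 1.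
Proof.
rewrite -(retr_inclK x) (mpolyE (retr_incl (S i) x)).
apply: (big_ind (fun z => exists a : K,
  pihomog mdeg d (phi i (retr_proj (S i) z)) =
  (a *+ (s i == d%:Z)) *: phi i 1)).
- by exists 0; rewrite !linear0 mul0rn scale0r.
- move=> y z [a ay] [b bz]; exists (a + b).
  by rewrite !linearD /= ay bz mulrnDl scalerDl.
move=> w _; set c := _@_w; rewrite !linearZ /=.
have pw : G ((mdeg w)%:Z + s i) (phi i (retr_proj (S i) 'X_[w])).
  by apply: phi_comp; apply: (@retr_proj_comp _ _ (S i) (mdeg w));
    rewrite /= dhomogX.
have [sd|sd] := eqVneq (s i) d%:Z; last first.
  exists 0; rewrite mul0rn scale0r.
  have := shift_ge_d i; have [e sE] : exists e : nat, s i = e%:Z.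
    by have := shift_ge_d i; case: (s i) => // e _; exists e.
  rewrite sE lez_nat => de; rewrite sE -PoszD in pw.
  rewrite (pihomog_ne0 _ pw) ?scaler0 //; apply: contraNneq sd => E.
  by rewrite sE; apply/eqP; congr Posz; lia.
have [w0|w0] := eqVneq w 0%MM.
  exists c; rewrite w0 mpolyX0 rmorph1 mulr1n pihomog_dE //.
  by have := phi1_comp i; rewrite sd.
exists 0; rewrite mul0rn scale0r; rewrite sd -PoszD in pw.
rewrite (pihomog_ne0 _ pw) ?scaler0 //; apply: contraNneq w0 => E.
by rewrite -mdeg_eq0; lia.
Qed.

Local Notation J := [set i | s i == d%:Z].

(** By [pihomog_phi] the elements [phi i 1] with shift [d] span the degree [d] part of the ideal,
    which has a basis of monomials. *)
Lemma card_shift_d : (size (veronese_monomials n d d) <= #|J|)%N.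
Proof.
set L := veronese_monomials n d d.
have Lu : uniq L by rewrite filter_uniq ?monomials_uniq.
pose X (l : 'I_(size L)) : R := 'X_[nth 0%MM L l].
have XL l : {subset msupp (X l) <= L}.
  by move=> w; rewrite msuppX inE => /eqP ->; apply: mem_nth.
have [a aE] : exists a : 'I_(size L) -> 'I_m -> K,
    forall l, X l = \sum_(i in J) a l i *: phi i 1.
  apply: (@fin_all_exists _ (fun=> 'I_m -> K)
    (fun l a => X l = \sum_(i in J) a i *: phi i 1)) => l.
  have [MX GX] : M (X l) /\ G d%:Z (X l) by apply/squarefree_veronese_compP.
  have /phi_img[x xE] := MX.
  have [a aE] := fin_all_exists (fun i => pihomog_phi (x i)).
  exists a; rewrite -[LHS](pihomog_dE (mf := mdeg) GX) xE linear_sum /=.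
  rewrite [RHS]big_mkcond /=; apply: eq_bigr => i _.
  by rewrite aE inE; case: eqP; rewrite ?mulr1n // mulr0n scale0r.
rewrite -[size L]card_ord.
apply: (@lin_indep_leq_in K R _ _ predT J X (fun i => phi i 1) a) => //.
move=> c c0 l _.
have := congr1 (mcoeff (nth 0%MM L l)) c0.
rewrite mcoeff0 linear_sum (bigD1 l) //= linearZ /= mcoeffX eqxx mulr1.
rewrite big1 ?addr0 // => i /negPf il; rewrite linearZ /= mcoeffX nth_uniq //.
by rewrite -[_ == _ :> nat]/(i == l) il mulr0.
Qed.

(** Each summand with shift [d] offers [r] independent elements of degree 1; together their images
    stay independent and lie in degree [d.+1] of the ideal. *)
Lemma card_shift_d_mul r : (forall i, r <= \rank (retract_mx (S i)))%N ->
  (#|J| * r <= size (veronese_monomials n d d.+1))%N.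
Proof.
move=> r_le; set L := veronese_monomials n d d.+1.
have Lu : uniq L by rewrite filter_uniq ?monomials_uniq.
have [v vP] : exists v : forall i, 'I_r -> S i,
    forall i, (forall l, retr_comp 1 (v i l)) /\
      forall c : 'I_r -> K, \sum_l c l *: v i l = 0 -> forall l, c l = 0.
  apply: (@fin_all_exists _ (fun i => 'I_r -> S i) (fun i u =>
    (forall l, retr_comp 1 (u l)) /\
      forall c : 'I_r -> K, \sum_l c l *: u l = 0 -> forall l, c l = 0)) => i.
  have [u [u1 u_indep]] := retract_degree1 (S i).
  exists (fun l => u (widen_ord (r_le i) l)); split=> // c c0 l.
  (* [c'] extends [c] by zero from the first [r] basis elements to all of them. *)
  pose c' j := \sum_(l | widen_ord (r_le i) l == j) c l.
  have <- : c' (widen_ord (r_le i) l) = c l.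
    by rewrite /c' (big_pred1 l).
  apply: u_indep; rewrite -[RHS]c0 /c'.
  under eq_bigr do rewrite scaler_suml.
  rewrite (exchange_big_dep predT) //=; apply: eq_bigr => l' _.
  by rewrite (big_pred1 (widen_ord (r_le i) l')) // => j; rewrite /= eq_sym.
pose u (p : 'I_m * 'I_r) : R := phi p.1 (v p.1 p.2).
have -> : (#|J| * r)%N = #|setX J [set: 'I_r]| by rewrite cardsX cardsT
  card_ord.
rewrite -[size L]card_ord.
apply: (@lin_indep_leq_in K R _ _ (setX J setT) predT u
  (fun l : 'I_(size L) => 'X_[nth 0%MM L l])
  (fun p l => (u p)@_(nth 0%MM L l))) => [[i l]|c c0 [i l]].
  rewrite !inE andbT => /eqP si; apply: mpoly_expand_in => //.
  apply/squarefree_veronese_compP; split.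
    exact: (phi_in_img i (fun j => v j l)).
  rewrite -[d.+1]add1n PoszD -si; apply: phi_comp; exact: (vP i).1.
rewrite !inE andbT => /eqP si.
have x0 : \sum_i phi i (\sum_l (c (i, l) *+ (i \in J)) *: v i l) = 0.
  under eq_bigr do rewrite linear_sum.
  rewrite pair_big /= -[RHS]c0 [RHS]big_mkcond /=;
    apply: eq_bigr => -[j k] _ /=.
  rewrite linearZ /= !inE andbT /u /=.
  by case: eqP; rewrite ?mulr1n // mulr0n scale0r.
have := (vP i).2 _ (phi_inj x0 i) l.
by rewrite inE si eqxx mulr1n.
Qed.

End UpperBound.

(** The two counts give C(n, d) r <= d C(n, d) + C(n, d + 1); dividing by C(n, d) and using (d + 1)
    C(n, d + 1) = (n - d) C(n, d) yields the bound. *)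
Lemma decomposition_depth_leq (K : fieldType) (n d r : nat) :
  (0 < d)%N -> (d <= n)%N ->
  has_decomposition_of_depth n
    (@mpoly_comp K n) (@squarefree_veronese K n d) r ->
  (r <= d + (n - d) %/ d.+1)%N.
Proof.
move=> d0 dn [m [S [s [[phi [phi_comp phi_img phi_inj]] _ rmin]]]].
have r_le i : (r <= \rank (retract_mx (S i)))%N.
  by apply: leq_depth_rank => r'; apply: rmin.
have h1 := card_shift_d phi_comp phi_img phi_inj.
have := card_shift_d_mul phi_comp phi_img phi_inj r_le.
rewrite size_veronese_monomials_dS //;
  rewrite size_veronese_monomials_d // in h1.
move=> h2; have {h1 h2} h : ('C(n, d) * r <= d * 'C(n, d) + 'C(n, d.+1))%N.
  by apply: leq_trans h2; rewrite leq_mul2r h1 orbT.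
rewrite -leq_subLR leq_divRL //.
have C0 : (0 < 'C(n, d))%N by rewrite bin_gt0.
have := mul_bin_left n d.
rewrite -(leq_pmul2r C0); move: ('C(n, d)) ('C(n, d.+1)) h => a b.
nia.
Qed.

(** * The lower bound *)

Section MonomialMaps.
Variables (K : fieldType) (p n : nat) (g : 'X_{1..p} -> 'X_{1..n}).
Implicit Type f : {mpoly K[p]}.

(** Decompositions ask only for linear maps, so exponent vectors may be moved by an arbitrary
    [g]. *)
Definition monomial_map f : {mpoly K[n]} :=
  \sum_(w <- msupp f) f@_w *: 'X_[g w].

Lemma monomial_mapwE f k : (msize f <= k)%N ->
  monomial_map f = \sum_(w : 'X_{1..p < k}) f@_w *: 'X_[g w].
Proof.
move=> le_fk; set I : subFinType _ := 'X_{1..p < k}.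
rewrite /monomial_map (big_mksub I) ?msupp_uniq //=; first last.
  by move=> x /msize_mdeg_lt /leq_trans; apply.
rewrite big_rmcond //= => j /memN_msupp_eq0 ->.
by rewrite scale0r.
Qed.

Lemma monomial_map_is_linear : linear monomial_map.
Proof.
move=> a f f'; set k := maxn (msize f) (msize f').
have fk : (msize f <= k)%N by apply: leq_maxl.
have fk' : (msize f' <= k)%N by apply: leq_maxr.
rewrite (@monomial_mapwE (a *: f + f') k); last first.
  apply: leq_trans (msizeD_le _ _) _; rewrite geq_max fk' andbT.
  exact: leq_trans (mmeasureZ_le _ _ _) fk.
rewrite (monomial_mapwE fk) (monomial_mapwE fk') scaler_sumr -big_split /=.
by apply: eq_bigr => w _; rewrite mcoeffD mcoeffZ scalerDl scalerA.
Qed.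

HB.instance Definition _ :=
  GRing.isLinear.Build K {mpoly K[p]} {mpoly K[n]} _ monomial_map
    monomial_map_is_linear.

Lemma monomial_mapX w : monomial_map 'X_[w] = 'X_[g w].
Proof. by rewrite /monomial_map msuppX big_seq1 mcoeffX eqxx scale1r. Qed.

Lemma mcoeff_monomial_map f w : injective g -> (monomial_map f)@_(g w) = f@_w.
Proof.
move=> g_inj; rewrite linear_sum /=.
under eq_bigr do rewrite linearZ /= mcoeffX (inj_eq g_inj).
have [wf|wf] := boolP (w \in msupp f).
  rewrite (bigD1_seq w) //= eqxx mulr1 big1 ?addr0 // => v /negPf ->.
  by rewrite mulr0.
rewrite (memN_msupp_eq0 wf) big_seq big1 // => v vf.
by case: eqP => [vw|]; rewrite ?mulr0 // -vw vf in wf *.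
Qed.

Lemma msupp_monomial_map f v : v \in msupp (monomial_map f) ->
  exists2 w, w \in msupp f & v = g w.
Proof.
move=> vf; have : v \in [seq g w | w <- msupp f];
  last by case/mapP=> w; exists w.
apply: contraLR vf => vf; rewrite -mcoeff_eq0 linear_sum big_seq.
rewrite big1 // => w wf /=.
rewrite linearZ /= mcoeffX; case: eqP => [E|]; last by rewrite mulr0.
by rewrite -E map_f in vf.
Qed.

End MonomialMaps.

(** In each degree, elements at equal positions of the two lists are matched. *)
Lemma graded_bijection (X Y : eqType) (y0 : Y) (deg : X -> nat)
    (LX : nat -> seq X) (LY : nat -> seq Y) :
  (forall k x, (x \in LX k) = (deg x == k)) ->
  (forall k, uniq (LX k)) -> (forall k, uniq (LY k)) ->
  (forall k, size (LX k) = size (LY k)) ->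
  exists psi : X -> Y, [/\ forall x, psi x \in LY (deg x),
    forall x x', deg x = deg x' -> psi x = psi x' -> x = x' &
    forall k y, y \in LY k -> exists2 x, deg x = k & psi x = y].
Proof.
move=> memLX LXu LYu szE.
have idx x : (index x (LX (deg x)) < size (LY (deg x)))%N.
  by rewrite -szE index_mem memLX.
exists (fun x => nth y0 (LY (deg x)) (index x (LX (deg x))));
  split=> [x|x x' dE|k y yk].
- exact: mem_nth.
- have := idx x'; rewrite -dE => idx' /eqP; rewrite nth_uniq // => /eqP E.
  have xL : x \in LX (deg x) by rewrite memLX.
  have xL' : x' \in LX (deg x) by rewrite memLX dE.
  by rewrite -(nth_index x xL) E nth_index.
have yi : (index y (LY k) < size (LX k))%N by rewrite szE index_mem.
have x0 : X by case: (LX k) yi => [|x l].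
pose x := nth x0 (LX k) (index y (LY k)).
have xk : deg x = k by apply/eqP; rewrite -memLX mem_nth.
by exists x => //; rewrite xk /x index_uniq // nth_index.
Qed.

Section NumericalDecomposition.
Variables (K : fieldType) (n d m : nat) (p s : 'I_m -> nat).
Hypotheses (p_gt0 : forall i, (0 < p i)%N) (pn : forall i, (p i <= n)%N).
Hypothesis hfE : forall k,
  (\sum_i shifted_hf (p i) (s i) k)%N = size (veronese_monomials n d k).

Local Notation X := {i : 'I_m & 'X_{1..p i}}.
Let deg (x : X) := (mdeg (tagged x) + s (tag x))%N.
Let LX k : seq X := [seq Tagged (fun i => 'X_{1..p i}) w | i <- enum 'I_m,
  w <- if (s i <= k)%N then monomials (p i) (k - s i) else [::]].

Lemma size_monomials q k : (0 < q)%N ->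
  size (monomials q k) = 'C(k + q.-1, q.-1).
Proof.
case: q => // q _; rewrite -size_compositions -monomialsE size_map.
by [].
Qed.

Lemma shifted_monomials_bijection : exists psi : X -> 'X_{1..n},
  [/\ injective psi, forall x, mdeg (psi x) = deg x &
      forall w : 'X_{1..n}, (d <= nnz w)%N <-> exists x, psi x = w].
Proof.
have [k x|k|k|k|psi [psiL psi_inj psi_surj]] :=
  @graded_bijection X _ 0%MM deg LX (veronese_monomials n d).
- apply/allpairsPdep/eqP => [[i [w [_ wk ->]]]|<-].
    by move: wk; case: leqP => // sk;
      rewrite mem_monomials /deg /= => /eqP ->; rewrite subnK.
  case: x => i w; exists i, w; rewrite mem_enum; split=> //.
  by rewrite /deg /= leq_addl addnK mem_monomials.
- apply: allpairs_uniq_dep => [|i _|]; first exact: enum_uniq.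
    by case: leqP => // _; apply: monomials_uniq.
  by move=> [i w] [i' w'] _ _ /=.
- by rewrite filter_uniq ?monomials_uniq.
- rewrite -hfE size_allpairs_dep sumnE big_map big_enum; apply: eq_bigr => i _.
  by rewrite /shifted_hf; case: leqP => // _; rewrite size_monomials.
have psiP x : mdeg (psi x) = deg x /\ (d <= nnz (psi x))%N.
  by have := psiL x; rewrite mem_filter mem_monomials => /andP[-> /eqP].
exists psi; split=> [x x' E|x|w].
- by apply: psi_inj => //; rewrite -!(psiP _).1 E.
- exact: (psiP x).1.
split=> [dw|[x <-]]; last exact: (psiP x).2.
have [|x _ <-] := psi_surj (mdeg w) w; last by exists x.
by rewrite mem_filter dw mem_monomials /=.
Qed.

(** Equal Hilbert functions allow a degree-preserving bijection from the monomials of all summands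
    to those of the ideal, and this extends linearly. *)
Lemma numerical_decomposition :
  is_hilbert_decomposition (@mpoly_comp K n) (@squarefree_veronese K n d)
    (fun i => poly_retract K (pn i)) (fun i => (s i)%:Z).
Proof.
have [psi [psi_inj psi_deg psi_img]] := shifted_monomials_bijection.
pose g i (w : 'X_{1..p i}) := psi (Tagged (fun i => 'X_{1..p i}) w).
have g_inj i : injective (g i).
  by move=> w w' /psi_inj/eqP; rewrite eq_Tagged /= => /eqP.
pose phi i : {linear poly_retract K (pn i) -> {mpoly K[n]}} :=
  @monomial_map K _ _ (g i).
exists phi; split=> [i k x xk|v|x x0 i].
- case: k xk => k /= xk; last by rewrite xk linear0; apply: mpoly_comp0.
  apply/dhomogP => v /msupp_monomial_map[w wx ->] /=.
  by rewrite psi_deg /deg /= (dhomog_mf xk).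
- split=> [/squarefree_veroneseP vM|[x ->]].
    rewrite (mpolyE v) big_seq.
    apply: (big_ind (fun f =>
      exists x : forall i, poly_retract K (pn i), f = \sum_i phi i (x i))).
    + by exists (fun=> 0); rewrite big1 // => i _; rewrite linear0.
    + move=> f f' [x ->] [x' ->]; exists (fun i => x i + x' i).
      by rewrite -big_split; apply: eq_bigr => i _; rewrite linearD.
    move=> w /vM /psi_img[[i u] uw].
    (* [dfwith] places [u] at [i] and merely supplies entries of the right type elsewhere, which the
       scalar kills. *)
    exists (fun j => (j == i)%:R *:
      (v@_w *: 'X_[dfwith (fun i => 0%MM : 'X_{1..p i}) u j])).
    rewrite (bigD1 i) //= eqxx scale1r big1 => [|j /negPf ->]; last first.
      by rewrite scale0r linear0.
    by rewrite addr0 dfwith_in linearZ /= monomial_mapX /g uw.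
  apply/squarefree_veroneseP => w; rewrite mcoeff_msupp => xw.
  apply/psi_img; have /existsP[i] : [exists i, (phi i (x i))@_w != 0].
    apply: contraNT xw => /existsPn xw; rewrite linear_sum big1 // => i _.
    by apply/eqP/negPn/xw.
  rewrite -mcoeff_msupp => /msupp_monomial_map[u _ ->].
  by exists (Tagged (fun i => 'X_{1..p i}) u).
apply/mpolyP => w; rewrite mcoeff0.
have := congr1 (mcoeff (g i w)) x0.
rewrite mcoeff0 linear_sum (bigD1 i) //= mcoeff_monomial_map //.
(* No other summand meets the monomial [g i w], since [psi] is injective on the disjoint union. *)
rewrite big1 ?addr0 // => j ji; apply/eqP; rewrite mcoeff_eq0; apply/negP.
move=> /msupp_monomial_map[u _ /psi_inj/(congr1 tag)] /= ij.
by rewrite ij eqxx in ji.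
Qed.

End NumericalDecomposition.

Lemma floor_natr_div (a b : nat) : (0 < b)%N ->
  Num.floor (a%:R / b%:R : rat) = (a %/ b)%N%:Z.
Proof.
move=> b0; have b0' : 0 < (b%:R : rat) by rewrite ltr0n.
apply: floor_def; rewrite ler_pdivlMr // ltr_pdivrMr //.
rewrite -PoszD -!pmulrn -!natrM ler_nat ltr_nat addn1.
by rewrite leq_divM ltn_ceil.
Qed.

Lemma floor_bin_ratio n d : (d <= n)%N ->
  Num.floor ('C(n, d.+1)%:R / 'C(n, d)%:R : rat) = ((n - d) %/ d.+1)%N%:Z.
Proof.
move=> dn; rewrite -floor_natr_div //; congr Num.floor.
have C0 : ('C(n, d)%:R : rat) != 0 by rewrite pnatr_eq0 -lt0n bin_gt0.
have d0 : (d.+1%:R : rat) != 0 by rewrite pnatr_eq0.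
apply/eqP; rewrite eqr_div // -!natrM; apply/eqP; congr (_%:R).
by rewrite mulnC mul_bin_left.
Qed.

Lemma ceil_natr_div (a b : nat) : (0 < b)%N ->
  Num.ceil (a.+1%:R / b%:R : rat) = (a %/ b)%N%:Z + 1.
Proof.
move=> b0; have b0' : 0 < (b%:R : rat) by rewrite ltr0n.
apply: ceil_def; rewrite addrK ler_pdivrMr // ltr_pdivlMr //.
rewrite -PoszD -!pmulrn -!natrM ler_nat ltr_nat addn1.
by rewrite ltnS leq_divM ltn_ceil.
Qed.

Lemma sum_flatten_nseq (I : Type) (T : Type) (r : seq I)
    (c : I -> nat) (x : I -> T)
    (F : T -> nat) :
  (\sum_(y <- flatten [seq nseq (c i) (x i) | i <- r]) F y =
    \sum_(i <- r) c i * F (x i))%N.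
Proof.
rewrite big_flatten big_map; apply: eq_bigr => i _.
by rewrite big_nseq iter_addn_0 mulnC.
Qed.

Section LowerBound.
Variables (n d : nat).
Hypotheses (d_gt0 : (0 < d)%N) (dn : (d <= n)%N).
Local Notation q := ((n - d) %/ d.+1)%N.

(** Supports of size s > d + q contribute C(n, s) rings in s variables as they stand; the smaller
    supports are regrouped into rings in d + q variables by [bernstein_decomposition]. The member (d
    + q, d) shows that the minimum is attained. *)
Lemma veronese_numerical_decomposition : exists fam : seq (nat * nat),
  [/\ {in fam, forall x, (d + q <= x.1 <= n)%N}, (d + q, d)%N \in fam &
   forall k, (\sum_(x <- fam) shifted_hf x.1 x.2 k)%N =
     size (veronese_monomials n d k)].
Proof.
have qn : (d + q <= n)%N by rewrite -leq_subRL // leq_div.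
have [a [a0 aE]] := bernstein_decomposition d_gt0 (leq_divM (n - d) d.+1) dn.
exists (flatten [seq nseq (a j) (d + q, d + j)%N | j <- index_iota 0 q.+1] ++
        flatten [seq nseq 'C(n, s) (s, s) | s <- index_iota (d + q).+1 n.+1]).
split=> [x||k].
- rewrite mem_cat => /orP[] /flattenP[l /mapP[j jI ->]] /nseqP[-> _] /=.
    by rewrite leqnn.
  by move: jI; rewrite mem_index_iota ltnS => /andP[/ltnW-> ->].
- rewrite mem_cat; apply/orP; left; apply/flattenP.
  exists (nseq (a 0%N) (d + q, d + 0)%N); last first.
    by rewrite mem_nseq a0 bin_gt0 dn addn0 eqxx.
  by apply/mapP; exists 0%N; rewrite ?mem_index_iota.
rewrite big_cat !sum_flatten_nseq /= -aE size_veronese_monomials.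
rewrite [RHS](big_cat_nat _ (n := (d + q).+1)) ?(leqW (leq_addr _ _)) //=.
congr (_ + _)%N; last first.
  by apply: eq_big_nat => s /andP[s0 _]; rewrite pos_compositions_cardE //;
    apply: leq_ltn_trans s0.
rewrite -[d in RHS]add0n [RHS]big_addn add0n.
have -> : ((d + q).+1 - d = q.+1)%N by rewrite -addnS addKn.
by apply: eq_bigr => t _; rewrite addnC pos_compositions_cardE // addn_gt0
  d_gt0 orbT.
Qed.

Lemma veronese_depth_decomposition (K : fieldType) :
  has_decomposition_of_depth n (@mpoly_comp K n) (@squarefree_veronese K n d)
    (d + q).
Proof.
have [fam [famP fam_mem famE]] := veronese_numerical_decomposition.
pose x (i : 'I_(size fam)) := nth (0, 0)%N fam i.
have xP i : (d + q <= (x i).1 <= n)%N by apply/famP/mem_nth.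
have xn i : ((x i).1 <= n)%N by case/andP: (xP i).
exists (size fam), (fun i => poly_retract K (xn i)), (fun i => (x i).2%:Z);
  split.
- apply: numerical_decomposition => [i|k].
    by case/andP: (xP i) => + _; apply: leq_trans; rewrite addn_gt0 d_gt0.
  by rewrite -famE (big_nth (0, 0)%N) big_mkord.
- have i0 : (index (d + q, d)%N fam < size fam)%N by rewrite index_mem.
  exists (Ordinal i0); have := poly_retract_depth K (xn (Ordinal i0)).
  by rewrite {2}/x /= nth_index.
move=> i r' [_ r'max]; apply: leq_trans (_ : (x i).1 <= _)%N;
  first by case/andP: (xP i).
(* [r'] bounds the length of every regular sequence in the irrelevant ideal, so one of length
   [(x i).1] suffices. *)
have [[fs [fsI reg fs_size]] _] := poly_retract_depth K (xn i).
by rewrite -fs_size; apply: r'max.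
Qed.

End LowerBound.

Theorem theorem1p2 (K : fieldType) (n d : nat) (hd : (1 <= d)%N)
    (hdn : (d <= n)%N) :
  is_hilbert_series (@mpoly_comp K n) (@squarefree_veronese K n d)
    (fun k => \sum_(d.-1 <= i < n)
       'C(i, d.-1)%:Z *
         laurent_shift d
           (fps_1subT_pow (- n%:Z + i%:Z - d%:Z + 1)) k) /\
  (exists h : nat,
    [/\ is_hilbert_depth n (@mpoly_comp K n) (@squarefree_veronese K n d) h,
        h%:Z = d%:Z + Num.floor ('C(n, d.+1)%:R / 'C(n, d)%:R : rat),
        h%:Z = d%:Z + Num.floor ((n%:R - d%:R) / (d%:R + 1) : rat)
      & h%:Z = d%:Z - 1 +
               Num.ceil ((n%:R - (d%:R - 1)) / (d%:R + 1) : rat)]).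
Proof.
split=> [k|].
  rewrite veronese_hilbert_seriesE //; case: k => k.
    exists (size (veronese_monomials n d k)); split=> //.
    apply: has_dim_monomials; first by rewrite filter_uniq ?monomials_uniq.
    exact: squarefree_veronese_compP.
  exists 0%N; split=> //; apply: (@has_dim_monomials K n _ [::]) => // f; split.
    by move=> [_ /= ->]; rewrite msupp0.
  case E : (msupp f) => [|w l] fL; last by have := fL w (mem_head _ _).
  split; last by apply/eqP; rewrite -msupp_eq0 E.
  by apply/squarefree_veroneseP; rewrite E.
exists (d + (n - d) %/ d.+1)%N; split.
- split; first exact: veronese_depth_decomposition.
  by move=> r'; apply: decomposition_depth_leq.
- by rewrite floor_bin_ratio // PoszD.
- by rewrite -natrB // natr1 floor_natr_div // PoszD.
have -> : (n%:R - (d%:R - 1) : rat) = (n - d).+1%:R.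
  by rewrite -natr1 natrB //; ring.
by rewrite natr1 ceil_natr_div // PoszD; ring.
Qed.
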